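(* Let $(e_i)_{i\ge1}$ be a sequence of natural numbers such that $E=\bigcup_{i\ge1}\{e_i\}$ is minimal. For $i\ge1$ let $\mathcal{P}_i$ be the set of all primes in the arithmetic progression $2^{i+1}\mathbb{Z}+2^i+1$. Then there exist $K_i\in\mathbb{N}$, $i\ge1$, such that for all sets $A_i\subseteq\mathcal{P}_i\cap[K_i,\infty)$, $i\ge1$, each of which is infinite, pairwise coprime and thin, the set $B=\bigcup_{i\ge1}e_iA_i$ is Besicovitch and $B^*=E$. Moreover, if additionally $\bigcup_{i\ge1}A_i$ is thin, then $B$ is taut.
   Context: $\mathbb{N}=\{1,2,\dots\}$. For $d\in\mathbb{N}$ and $A\subseteq\mathbb{N}$, $dA=\{da:a\in A\}$. For $B\subseteq\mathbb{N}$ let $\mathcal{M}_B=\bigcup_{b\in B}b\mathbb{Z}$ and $\mathcal{F}_B=\mathbb{Z}\setminus\mathcal{M}_B$. For $A\subseteq\mathbb{Z}$, the natural density is $d(A)=\lim_{n\to\infty}\frac1n|A\cap[1,n]|$ (if it exists) and the logarithmic density is $\delta(A)=\lim_{n\to\infty}\frac{1}{\ln n}\sum_{1\le k\le n,\,k\in A}\frac1k$; $\delta(\mathcal{M}_B)$ exists for every $B\subseteq\mathbb{N}$ (Davenport--Erdős). $B$ is Besicovitch if $d(\mathcal{M}_B)$ exists. $B$ is thin if $\sum_{b\in B}1/b<\infty$. $B$ is taut if $\delta(\mathcal{M}_{B\setminus\{b\}})<\delta(\mathcal{M}_B)$ for every $b\in B$. $B$ is primitive if $b\mid b'$ with $b,b'\in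 B$ implies $b=b'$; $B^{prim}=B\setminus\bigcup_{k\ge2}kB$. $B$ is minimal if it is primitive and for every $n\in\mathbb{Z}$ there is $s_n\in\mathbb{N}$ such that either $n+s_n\mathbb{Z}\subseteq\mathcal{M}_B$ or $n+s_n\mathbb{Z}\subseteq\mathcal{F}_B$. Put $D(B)=\{d\in\mathbb{N}: dA\subseteq B\text{ for some infinite pairwise coprime set }A\subseteq\mathbb{N}\}$ and define $B^*=(B\cup D(B))^{prim}$. *)

(* Defs.v *)
From HB Require Import structures.
From mathcomp Require Import all_boot all_order all_algebra.
From mathcomp Require Import all_classical all_reals all_analysis.
Set Implicit Arguments.
Unset Strict Implicit.
Unset Printing Implicit Defensive.
Import Order.TTheory GRing.Theory Num.Theory.
Import numFieldNormedType.Exports.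
Local Open Scope classical_set_scope.
Local Open Scope ring_scope.

(* MathComp's nat contains 0, whereas the natural numbers of the paper start
   at 1; membership in [posn] is required explicitly where it matters. *)
Definition posn : set nat := [set n | (0 < n)%N].

Definition dilate (d : nat) (A : set nat) : set nat :=
  [set (d * a)%N | a in A].

(* n + sZ *)
Definition progression (n : int) (s : nat) : set int :=
  [set z | (z = n %[mod s%:Z])%Z].

(* M_B *)
Definition multiples (B : set nat) : set int :=
  \bigcup_(b in B) [set z | (b%:Z %| z)%Z].

(* F_B *)
Definition free (B : set nat) : set int := ~` multiples B.

(* The terms at n = 0 (and n = 1 in the logarithmic case) are junk values
   coming from 0^-1 = 0; they do not affect limits. *)
Definition natural_density_seq (R : realType) (A : set int) (n : nat) : R :=
  n%:R^-1 * (\sum_(1 <= k < n.+1 | k%:Z \in A) 1)%N%:R.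

Definition log_density_seq (R : realType) (A : set int) (n : nat) : R :=
  (ln n%:R)^-1 * \sum_(1 <= k < n.+1 | k%:Z \in A) k%:R^-1.

(* Meaningful when the limit exists; by the Davenport-Erdos theorem this is
   the case for A = multiples B with B any set of positive integers. *)
Definition log_density (R : realType) (A : set int) : R :=
  limn (log_density_seq R A).

Definition besicovitch (R : realType) (B : set nat) : Prop :=
  cvgn (natural_density_seq R (multiples B)).

Definition thin (R : realType) (B : set nat) : Prop :=
  (\esum_(b in B) (b%:R^-1 : R)%:E < +oo)%E.

Definition taut (R : realType) (B : set nat) : Prop :=
  forall b, B b ->
    log_density R (multiples (B `\ b)) < log_density R (multiples B).

Definition primitive (B : set nat) : Prop :=
  forall b b', B b -> B b' -> (b %| b')%N -> b = b'.

Definition prim (B : set nat) : set nat :=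
  B `\` \bigcup_(k in [set k | (2 <= k)%N]) dilate k B.

Definition minimal (B : set nat) : Prop :=
  primitive B /\
  forall n : int, exists2 s : nat, posn s &
    progression n s `<=` multiples B \/ progression n s `<=` free B.

Definition pairwise_coprime (A : set nat) : Prop :=
  forall a a', A a -> A a' -> a <> a' -> coprime a a'.

(* D(B) *)
Definition coprime_divisors (B : set nat) : set nat :=
  [set d | posn d /\ exists A : set nat,
     [/\ A `<=` posn, infinite_set A, pairwise_coprime A & dilate d A `<=` B]].

(* B^* *)
Definition star (B : set nat) : set nat := prim (B `|` coprime_divisors B).

(* P_i *)
Definition primes_in_class (i : nat) : set nat :=
  [set p | prime p /\ progression ((2 ^ i + 1)%N : int) (2 ^ i.+1)%N (p : int)].

(* Main.v *)
(* Since A_i consists of primes p >= K_i, every element of B is e p with p a prime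
   that is huge compared with e. The density of multiples of B is obtained from
   Erdos' criterion: it suffices that, for V a small power of N, few x <= N have a
   divisor b in B with b > N / V. Such an x has a prime factor p > N / V^2, and these x
   are rare by Chebyshev's bound. The criterion itself rests on comparing, for a
   divisor-closed set F, its count up to N / b >= V with its density: both are controlled
   by the sum of 1/u over u <= N / b in F, up to the factor ln N / ln V. Summing over the
   least divisor b in B of x, the multiples whose least divisor lies in (z, N / V] have
   upper density O(d_N - d_z), where d_z is the density of the multiples of B up to z.

   B^* = E only needs minimality of E: an element of D(B) outside M_E would have a
   progression contained in F_E around it, which contains a multiple of an element of B.

   For tautness, B is primitive, and the sieve bound prod (1 - 1/q) > 0 over the
   q = c / gcd(c, b), c in B other than b, bounds below the density of the multiples of b
   that are not multiples of another element. Natural density gives logarithmic density. *)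

Require Import Defs.
From HB Require Import structures.
From mathcomp Require Import all_boot all_order all_algebra.
From mathcomp Require Import all_classical all_reals all_analysis.
From mathcomp Require Import zify ring lra.
Set Implicit Arguments.
Unset Strict Implicit.
Unset Printing Implicit Defensive.
Import Order.TTheory GRing.Theory Num.Theory.
Import numFieldNormedType.Exports.
Local Open Scope classical_set_scope.
Local Open Scope ring_scope.

(** * The von Mangoldt function and Chebyshev's bound *)

Lemma sum_dvdn (V : nmodType) (f : nat -> V) (d N : nat) : (0 < d)%N ->
  \sum_(1 <= n < N.+1 | (d %| n)%N) f n =
  \sum_(1 <= m < (N %/ d).+1) f (d * m)%N.
Proof.
move=> d0; elim: N => [|N IH]; first by rewrite div0n !big_nil.
rewrite big_mkcond big_nat_recr //= -big_mkcond /= IH divnS //.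
case: (boolP (d %| N.+1)%N) => dN /=; last by rewrite add0n addr0.
rewrite add1n [RHS]big_nat_recr //=; congr (_ + f _).
by have := divnK dN; rewrite divnS // dN mulnC add1n.
Qed.

(** At most one pair (p, a) contributes, namely the one with d = p ^ a. The double sum needs no test
    for prime powers and exchanges directly with sums over d. *)
Definition vonMangoldt (R : realType) (d : nat) : R :=
  \sum_(1 <= p < d.+1 | prime p) \sum_(1 <= a < d.+1 | (p ^ a == d)%N) ln p%:R.

Lemma vonMangoldt_ge0 (R : realType) (d : nat) : 0 <= vonMangoldt R d.
Proof.
rewrite /vonMangoldt big_nat_cond; apply: sumr_ge0 => p /andP[_ /prime_gt0 p0].
by apply: sumr_ge0 => a _; rewrite ln_ge0 // ler1n.
Qed.

(** Enlarging the ranges adds no term, since p ^ a = d with a >= 1 forces p <= d and a < d. A bound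
    [M] independent of d is what allows the exchange of sums. *)
Lemma vonMangoldt_widen (R : realType) (d M : nat) : (0 < d <= M)%N ->
  vonMangoldt R d = \sum_(1 <= p < M.+1 | prime p)
    \sum_(1 <= a < M.+1 | (p ^ a == d)%N) ln p%:R.
Proof.
move=> /andP[d0 dM]; rewrite /vonMangoldt (@big_nat_widen _ _ _ _ _ M.+1) //.
rewrite [LHS]big_mkcond [RHS]big_mkcond; apply: eq_bigr => p _.
case: (boolP (prime p)) => //= pp.
rewrite (@big_nat_widen _ _ _ _ d.+1 M.+1) //.
have eqa : (fun a => (p ^ a == d)%N && (a < d.+1)%N) =1 (fun a => (p ^ a == d)%N).
  move=> a; case: eqP => //= <-; rewrite ltnS ltnW //.
  exact/ltn_expl/prime_gt1.
rewrite (eq_bigl _ _ eqa); case: ltnP => // dp.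
rewrite big_nat_cond big1 // => a /andP[/andP[a1 _] /eqP pa].
have : (p ^ 1 <= p ^ a)%N by rewrite leq_exp2l // prime_gt1.
by rewrite pa expn1 leqNgt dp.
Qed.

Lemma ln_le_vonMangoldt (R : realType) (p : nat) : prime p ->
  ln p%:R <= vonMangoldt R p.
Proof.
move=> pp; have p0 := prime_gt0 pp; rewrite /vonMangoldt.
have mem i : (0 < i <= p)%N -> i \in index_iota 1 p.+1.
  by rewrite mem_index_iota ltnS.
have lnge0 (q : nat) : prime q -> 0 <= ln q%:R :> R.
  by move=> /prime_gt0 q0; rewrite ln_ge0 // ler1n.
rewrite big_mkcond (bigD1_seq p) /=; [|by rewrite mem // p0 leqnn|exact: iota_uniq].
rewrite pp big_mkcond (bigD1_seq 1%N) /=; [|by rewrite mem|exact: iota_uniq].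
rewrite expn1 eqxx -addrA lerDl addr_ge0 //.
  by apply: sumr_ge0 => a _; case: ifP => // _; exact: lnge0.
apply: sumr_ge0 => q _; case: ifP => // pq.
by apply: sumr_ge0 => a _; exact: lnge0.
Qed.

Lemma ln_prod (R : realType) (I : eqType) (r : seq I) (P : pred I) (F : I -> R) :
  (forall i, P i -> 0 < F i) ->
  ln (\prod_(i <- r | P i) F i) = \sum_(i <- r | P i) ln (F i).
Proof.
move=> F0; elim: r => [|i r IH]; first by rewrite !big_nil ln1.
rewrite !big_cons; case: ifP => // Pi.
by rewrite lnM ?IH // posrE ?F0 // prodr_gt0.
Qed.

(** The exponent of p in n counts the a >= 1 with p ^ a dividing n; grouping these pairs (p, a) by d
    = p ^ a gives the identity. *)
Lemma ln_sum_vonMangoldt (R : realType) (n M : nat) : (0 < n <= M)%N ->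
  ln n%:R = \sum_(1 <= d < M.+1 | (d %| n)%N) vonMangoldt R d.
Proof.
move=> /andP[n0 nM].
transitivity (\sum_(1 <= p < M.+1 | prime p)
    \sum_(1 <= a < M.+1 | (p ^ a %| n)%N) (ln p%:R : R)).
  have en : n = (\prod_(1 <= p < M.+1 | prime p) p ^ logn p n)%N.
    rewrite -{1}(partnT n0) /partn (@big_nat_widen _ _ _ _ _ M.+1) // big_ltn_cond //=.
    rewrite expn0 mul1n big_mkcond [RHS]big_mkcond /=; apply: eq_bigr => p _.
    case: (boolP (prime p)) => pp; last by rewrite lognE (negbTE pp) expn0; case: ifP.
    case: ltnP => // np; suff -> : logn p n = 0%N by [].
    by apply/eqP; rewrite -leqn0 leqNgt logn_gt0 mem_primes pp n0 /= gtnNdvd.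
  rewrite {1}en natr_prod ln_prod => [|p /prime_gt0 p0]; last by rewrite ltr0n expn_gt0 p0.
  apply: eq_bigr => p pp; rewrite natrX lnXn ?ltr0n ?prime_gt0 //.
  rewrite [RHS](eq_bigl (fun a => a < (logn p n).+1)%N) ; last first.
    by move=> a; rewrite /= ltnS pfactor_dvdn.
  rewrite -(@big_nat_widen _ _ _ 1%N (logn p n).+1 M.+1 predT); last first.
    by rewrite ltnS (leq_trans _ nM) // ltnW // ltn_logl.
  by rewrite sumr_const_nat subn1.
transitivity (\sum_(1 <= d < M.+1 | (d %| n)%N) \sum_(1 <= p < M.+1 | prime p)
    \sum_(1 <= a < M.+1 | (p ^ a == d)%N) (ln p%:R : R)); last first.
  rewrite big_nat_cond [RHS]big_nat_cond; apply: eq_bigr => d /andP[dM _].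
  by rewrite -vonMangoldt_widen // -ltnS.
rewrite [RHS](exchange_big_dep_nat prime) //=; apply: eq_bigr => p pp.
rewrite [RHS](exchange_big_dep_nat xpredT) //= [LHS]big_mkcond; apply: eq_bigr => a _.
case: ifP => pan.
  have/andP[pa0 pan'] : (0 < p ^ a <= n)%N by rewrite expn_gt0 prime_gt0 //= dvdn_leq.
  rewrite (eq_bigl (fun d => d == p ^ a)%N) => [|d]; last first.
    by rewrite pp andbT eq_sym andbC; case: eqP => // ->.
  by rewrite big_nat1_eq pa0 ltnS (leq_trans pan' nM).
rewrite big1 // => d /andP[/andP[dn _] /eqP pa]; by rewrite pa dn in pan.
Qed.

Lemma ln_le_subr1 (R : realType) (x : R) : 0 < x -> ln x <= x - 1.
Proof.
move=> x0; have := @le_ln1Dx R (x - 1); rewrite addrCA subrr addr0; apply; lra.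
Qed.

Lemma ln2_ge (R : realType) : 2^-1 <= ln 2 :> R.
Proof.
have := @ln_le_subr1 R 2^-1; rewrite lnV ?posrE //; lra.
Qed.

Lemma ln_nat_ge (R : realType) (n : nat) : (2 <= n)%N -> 2^-1 <= ln n%:R :> R.
Proof.
move=> n2; apply: le_trans (ln2_ge R) _.
by rewrite ler_ln ?posrE ?ltr0n ?ler_nat //; apply: leq_trans n2.
Qed.

Lemma ln_nat_ge0 (R : realType) (n : nat) : 0 <= ln n%:R :> R.
Proof. by case: n => [|n]; [rewrite ln0|rewrite ln_ge0 // ler1n]. Qed.

Lemma ler_sum_sub (R : numDomainType) (F : nat -> R) (P Q : pred nat) (M N : nat) :
  (M <= N)%N -> (forall i, (0 < i <= M)%N -> P i -> Q i) -> (forall i, Q i -> 0 <= F i) ->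
  \sum_(1 <= i < M.+1 | P i) F i <= \sum_(1 <= i < N.+1 | Q i) F i.
Proof.
move=> MN PQ F0; rewrite (@big_nat_widen _ _ _ _ M.+1 N.+1) //.
rewrite big_nat_cond [leRHS]big_nat_cond big_mkcond [leRHS]big_mkcond /=.
apply: ler_sum => i _; case: (boolP (1 <= i < N.+1)%N) => //= /andP[i1 _].
case: (boolP (P i)) => /= [Pi|_]; last by case: ifP => // /F0.
case: ltnP => iM; first by rewrite (PQ i) ?i1.
by case: ifP => // /F0.
Qed.

Lemma sum_sum_dvdn (V : nmodType) (f : nat -> nat -> V) (N : nat) :
  \sum_(1 <= n < N.+1) \sum_(1 <= d < N.+1 | (d %| n)%N) f d n =
  \sum_(1 <= d < N.+1) \sum_(1 <= m < (N %/ d).+1) f d (d * m)%N.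
Proof.
rewrite (exchange_big_dep_nat xpredT) //= big_nat [RHS]big_nat.
by apply: eq_bigr => d /andP[d1 _]; rewrite sum_dvdn.
Qed.

Lemma ln_fact (R : realType) (n : nat) :
  ln n`!%:R = \sum_(1 <= k < n.+1) ln k%:R :> R.
Proof.
elim: n => [|n IH]; first by rewrite big_nil ln1.
by rewrite factS natrM lnM ?posrE ?ltr0n ?fact_gt0 // IH [RHS]big_nat_recr //= addrC.
Qed.

(** Among 1, ..., n exactly n %/ d numbers are divisible by d. The free bound [M] puts the
    expansions of ln (2m)! and ln m! over one range. *)
Lemma ln_fact_vonMangoldt (R : realType) (n M : nat) : (n <= M)%N ->
  ln n`!%:R = \sum_(1 <= d < M.+1) vonMangoldt R d *+ (n %/ d).
Proof.
move=> nM; rewrite ln_fact.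
transitivity (\sum_(1 <= k < n.+1) \sum_(1 <= d < n.+1 | (d %| k)%N) vonMangoldt R d).
  by rewrite big_nat [RHS]big_nat; apply: eq_bigr => k kn; rewrite -ln_sum_vonMangoldt.
rewrite (sum_sum_dvdn (fun d _ => vonMangoldt R d)).
rewrite (@big_cat_nat _ _ _ n.+1 1 M.+1) //= [X in _ = _ + X]big_nat [X in _ = _ + X]big1; last first.
  by move=> d /andP[nd _]; rewrite divn_small.
by rewrite addr0; apply: eq_bigr => d _; rewrite sumr_const_nat subn1.
Qed.

Definition chebyshev_psi (R : realType) (n : nat) : R :=
  \sum_(1 <= d < n.+1) vonMangoldt R d.

Lemma ln_bin_le (R : realType) (m : nat) : ln 'C(m.*2, m)%:R <= m.*2%:R :> R.
Proof.
have C0 : (0 < 'C(m.*2, m))%N by rewrite bin_gt0 -addnn leq_addr.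
have C2 : ('C(m.*2, m) <= 2 ^ m.*2)%N.
  rewrite -[2%N]/(1 + 1)%N Pascal (bigD1 (inord m)) //= inordK; last first.
    by rewrite ltnS -addnn leq_addr.
  by rewrite !exp1n !muln1 leq_addr.
apply: (@le_trans _ _ (ln (2 ^ m.*2)%N%:R)).
  by rewrite ler_ln ?posrE ?ltr0n ?expn_gt0 // ler_nat.
rewrite natrX lnXn // -[leRHS]mulr1 -[leLHS]mulr_natl.
apply: ler_wpM2l => //; have := @ln_le_subr1 R 2; lra.
Qed.

(** In the expansion of ln C(2m, m) the coefficient of the von Mangoldt function at d is 2m %/ d - 2
    (m %/ d): it is never negative, and at least 1 for m < d <= 2m. *)
Lemma chebyshev_psi_double (R : realType) (m : nat) :
  chebyshev_psi R m.*2 <= chebyshev_psi R m + m.*2%:R.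
Proof.
rewrite -lerBlDl; apply: le_trans (ln_bin_le R m).
have mm : (m <= m.*2)%N by rewrite -addnn leq_addr.
have -> : ln 'C(m.*2, m)%:R = ln (m.*2)`!%:R - ln m`!%:R *+ 2 :> R.
  have := @bin_fact m.*2 m mm; rewrite -{2}addnn addnK => <-.
  rewrite !natrM !lnM ?posrE ?mulr_gt0 ?ltr0n ?fact_gt0 ?bin_gt0 //.
  by rewrite mulr2n addrK.
rewrite (ln_fact_vonMangoldt R (leqnn _)) (ln_fact_vonMangoldt R mm).
rewrite -sumrMnl -sumrB /chebyshev_psi.
rewrite (@big_cat_nat _ _ _ m.+1 1 m.*2.+1) //= addrAC subrr add0r.
rewrite [leRHS](@big_cat_nat _ _ _ m.+1 1 m.*2.+1) //=.
have H d : 0 <= vonMangoldt R d *+ (m.*2 %/ d) - vonMangoldt R d *+ (m %/ d) *+ 2.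
  rewrite subr_ge0 -mulrnA ler_wpMn2l ?vonMangoldt_ge0 //.
  case: d => [|d]; first by rewrite !divn0.
  by rewrite leq_divRL // -muln2 mulnAC leq_mul ?leq_trunc_div.
apply: le_trans (_ : 0 + _ <= _); last first.
  by apply: lerD; [apply: sumr_ge0 => d _; exact: H|exact: lexx].
rewrite add0r big_nat [leRHS]big_nat; apply: ler_sum => d /andP[md dm].
rewrite (divn_small md) mulr0n mul0rn subr0.
have -> : vonMangoldt R d = vonMangoldt R d *+ 1 by rewrite mulr1n.
by rewrite -mulrnA ler_wpMn2l ?vonMangoldt_ge0 // mul1n divn_gt0 // (leq_ltn_trans _ md).
Qed.

Lemma chebyshev_psi_le (R : realType) (n : nat) : chebyshev_psi R n <= 6 * n%:R.
Proof.
have homo m k : (m <= k)%N -> chebyshev_psi R m <= chebyshev_psi R k.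
  by move=> mk; apply: ler_sum_sub => // i _; exact: vonMangoldt_ge0.
elim/ltn_ind: n => n IH; case: (ltnP n 2) => n2.
  case: n n2 {IH} => [|[|//]] _; first by rewrite /chebyshev_psi big_nil mulr0.
  rewrite /chebyshev_psi big_nat1 /vonMangoldt big_mkcond big_nat1 /=; lra.
have mn : (uphalf n < n)%N by lia.
apply: le_trans (homo n (uphalf n).*2 _) _; first by lia.
apply: le_trans (chebyshev_psi_double _ _) _; apply: le_trans (lerD (IH _ mn) (lexx _)) _.
(* With h the upper half of n, psi(2h) <= psi(h) + 2h <= 8h, and 8h <= 4n + 4 <= 6n because n >=
   2. *)
have : (8 * uphalf n <= 6 * n)%N by lia.
rewrite -(ler_nat R) -mul2n !natrM; lra.
Qed.

Lemma harmonic_le (R : realType) (n : nat) :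
  \sum_(1 <= k < n.+1) k%:R^-1 <= 1 + ln n%:R :> R.
Proof.
(* The case n = 0 relies on the default value ln 0 = 0. *)
elim: n => [|[_|n IH]]; first by rewrite big_nil ln0 // addr0.
  by rewrite big_nat1 ln1 addr0 invr1.
rewrite big_nat_recr //=; apply: le_trans (lerD IH (lexx _)) _.
have n1 : 0 < n.+1%:R :> R by []. have n2 : 0 < n.+2%:R :> R by [].
have := @ln_le_subr1 R (n.+1%:R / n.+2%:R) (divr_gt0 n1 n2).
rewrite ln_div ?posrE //; suff -> : n.+1%:R / n.+2%:R = 1 - n.+2%:R^-1 :> R.
  by move: (ln _) (ln _) (_^-1) => a b c; lra.
have e : n.+2%:R = n.+1%:R + 1 :> R by rewrite natr1.
by apply: (mulIf (lt0r_neq0 n2)); rewrite mulfVK ?lt0r_neq0 // mulrBl mulVf ?lt0r_neq0 // e mul1r addrK.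
Qed.

Lemma ln_le_harmonic (R : realType) (n : nat) :
  ln n.+1%:R <= \sum_(1 <= k < n.+1) k%:R^-1 :> R.
Proof.
elim: n => [|n IH]; first by rewrite big_nil ln1.
rewrite big_nat_recr //=; apply: le_trans _ (lerD IH (lexx _)).
have n1 : 0 < n.+1%:R :> R by []. have n2 : 0 < n.+2%:R :> R by [].
have := @ln_le_subr1 R (n.+2%:R / n.+1%:R) (divr_gt0 n2 n1).
rewrite ln_div ?posrE //; suff -> : n.+2%:R / n.+1%:R = 1 + n.+1%:R^-1 :> R.
  by move: (ln _) (ln _) (_^-1) => a b c; lra.
by rewrite -natr1 mulrDl mulfV ?lt0r_neq0 // mul1r.
Qed.

(** * Counting in divisor-closed sets and Mertens-type bounds *)

Definition cnt (P : pred nat) (N : nat) : nat := (\sum_(1 <= k < N.+1 | P k) 1)%N.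

Lemma natr_cnt (R : pzSemiRingType) (P : pred nat) (N : nat) :
  (cnt P N)%:R = \sum_(1 <= k < N.+1 | P k) 1 :> R.
Proof. by rewrite natr_sum. Qed.

(** Both sides run over the pairs (d, m) of positive integers with d m <= N. *)
Lemma hyperbola_exchange (V : nmodType) (f : nat -> nat -> V) (N : nat) :
  \sum_(1 <= d < N.+1) \sum_(1 <= m < (N %/ d).+1) f d m =
  \sum_(1 <= m < N.+1) \sum_(1 <= d < (N %/ m).+1) f d m.
Proof.
have H (g : nat -> nat -> V) : \sum_(1 <= d < N.+1) \sum_(1 <= m < (N %/ d).+1) g d m =
    \sum_(1 <= d < N.+1) \sum_(1 <= m < N.+1 | (d * m <= N)%N) g d m.
  rewrite big_nat [RHS]big_nat; apply: eq_bigr => d /andP[d1 _].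
  rewrite (@big_nat_widen _ _ _ 1%N (N %/ d).+1 N.+1) ?ltnS ?leq_div //.
  by apply: eq_bigl => m; rewrite ltnS leq_divRL // mulnC.
rewrite H (H (fun m d => f d m)) (exchange_big_dep_nat xpredT) //=.
by apply: eq_bigr => m _; apply: eq_bigl => d; rewrite mulnC.
Qed.

Lemma divn_le_div (R : realType) (m d : nat) : (0 < d)%N ->
  (m %/ d)%:R <= m%:R / d%:R :> R.
Proof. by move=> d0; rewrite ler_pdivlMr ?ltr0n // -natrM ler_nat leq_trunc_div. Qed.

(* Writing ln n as the sum of the von Mangoldt function over the divisors d of n
   and n = d m, the cofactor m stays in F, and summing over d gives psi(Y / m). *)
Lemma cnt_divisor_closed (R : realType) (F : pred nat) (Y : nat) :
  (forall m n, F n -> (m %| n)%N -> F m) ->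
  (cnt F Y)%:R * ln Y%:R <= 7 * Y%:R * \sum_(1 <= u < Y.+1 | F u) (u%:R^-1 : R).
Proof.
move=> Fdiv.
have lnF : \sum_(1 <= n < Y.+1 | F n) (ln n%:R : R) <=
    6 * Y%:R * \sum_(1 <= u < Y.+1 | F u) u%:R^-1.
  have -> : \sum_(1 <= n < Y.+1 | F n) (ln n%:R : R) = \sum_(1 <= n < Y.+1)
      \sum_(1 <= d < Y.+1 | (d %| n)%N) (if F n then vonMangoldt R d else 0).
    rewrite big_mkcond big_nat [RHS]big_nat; apply: eq_bigr => n nY.
    by case: ifP => _; [rewrite -ln_sum_vonMangoldt|rewrite big1].
  rewrite (sum_sum_dvdn (fun d n => if F n then vonMangoldt R d else 0)).
  apply: (@le_trans _ _ (\sum_(1 <= d < Y.+1) \sum_(1 <= m < (Y %/ d).+1)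
      (if F m then vonMangoldt R d else 0))).
    apply: ler_sum => d _; apply: ler_sum => m _.
    case: ifP => [Fdm|_]; first by rewrite (Fdiv m _ Fdm) ?dvdn_mull.
    by case: ifP => // _; exact: vonMangoldt_ge0.
  rewrite (hyperbola_exchange (fun d m => if F m then vonMangoldt R d else 0)).
  rewrite mulr_sumr big_nat [leRHS]big_nat_cond big_mkcond [leRHS]big_mkcond.
  apply: ler_sum => m _; case: ifP => //= /andP[m1 _].
  case: ifP => Fm; last by rewrite big1.
  apply: le_trans (chebyshev_psi_le R _) _; rewrite -mulrA ler_wpM2l //.
  exact: divn_le_div.
(* Since ln (Y / n) <= Y / n, replacing ln n by ln Y costs one more Y times the sum of reciprocals,
   which turns 6 into 7. *)
apply: (@le_trans _ _ (\sum_(1 <= n < Y.+1 | F n) (ln n%:R + Y%:R * n%:R^-1 : R))); last first.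
  rewrite big_split /= -mulr_sumr; move: lnF.
  by move: (Y%:R) (\sum_(_ <= _ < _ | _) _) (\sum_(_ <= _ < _ | _) _) => a b c; lra.
rewrite natr_cnt mulr_suml big_nat_cond [leRHS]big_nat_cond.
apply: ler_sum => n /andP[/andP[n1 nY] _]; rewrite mul1r -lerBlDl.
have n0 : 0 < n%:R :> R by rewrite ltr0n.
have Y0 : 0 < Y%:R :> R by rewrite ltr0n (leq_trans n1).
rewrite -ln_div ?posrE //; apply: le_trans (ln_le_subr1 _) _; first by rewrite divr_gt0.
by rewrite gerBl.
Qed.

(** An upper bound of the type of Mertens' first theorem: X! <= X ^ X is compared with its von
    Mangoldt expansion, keeping only the primes. *)
Lemma sum_ln_prime_div_le (R : realType) (X : nat) :
  \sum_(1 <= p < X.+1 | prime p) (ln p%:R / p%:R) <= 2 * ln X%:R :> R.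
Proof.
case: X => [|X']; first by rewrite big_nil ln0 // mulr0.
set X := X'.+1; have X0 : 0 < X%:R :> R by [].
have : ln X`!%:R <= X%:R * ln X%:R :> R.
  rewrite ln_fact; apply: (@le_trans _ _ (\sum_(1 <= k < X.+1) ln X%:R)).
    rewrite big_nat [leRHS]big_nat; apply: ler_sum => k /andP[k1 kX].
    by rewrite ler_ln ?posrE ?ltr0n ?ler_nat.
  by rewrite sumr_const_nat subn1 mulr_natl.
rewrite (ln_fact_vonMangoldt R (leqnn _)) => H.
suff : X%:R * \sum_(1 <= p < X.+1 | prime p) (ln p%:R / p%:R) <= X%:R * (2 * ln X%:R) :> R.
  by rewrite ler_pM2l.
rewrite [leRHS]mulrCA; apply: le_trans (ler_wpM2l _ H) => //.
rewrite !mulr_sumr big_nat_cond [leRHS]big_nat big_mkcond [leRHS]big_mkcond.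
apply: ler_sum => p _; case: (boolP (0 < p < X.+1)%N) => //= /andP[p0 pX].
case: (boolP (prime p)) => [pp|_]; last first.
  by rewrite mulr_ge0 // mulrn_wge0 // vonMangoldt_ge0.
apply: (@le_trans _ _ (2 * (ln p%:R *+ (X %/ p)))); last first.
  by rewrite ler_wpM2l // lerMn2r ln_le_vonMangoldt ?orbT.
rewrite -(mulr_natr (ln _) (X %/ p)) [leRHS]mulrCA [leLHS]mulrCA ler_wpM2l ?ln_nat_ge0 //.
rewrite ler_pdivrMr ?ltr0n // -!natrM ler_nat.
(* As the quotient is at least 1, X / p <= 2 (X %/ p); this is the source of the factor 2. *)
have q1 : (0 < X %/ p)%N by rewrite divn_gt0.
have := ltn_ceil X p0; nia.
Qed.

(** For distinct primes these are the squarefree integers supported on [s], each listed once, over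
    which the product of the 1 + 1/p expands. *)
Fixpoint subset_prods (s : seq nat) : seq nat :=
  if s is p :: s' then subset_prods s' ++ [seq (p * u)%N | u <- subset_prods s'] else [:: 1%N].

Lemma subset_prods_prime (s : seq nat) : all prime s -> uniq s ->
  [/\ uniq (subset_prods s), all (fun u => 0 < u)%N (subset_prods s) &
   forall p u, prime p -> u \in subset_prods s -> (p %| u)%N -> p \in s].
Proof.
elim: s => [_ _|p s IH /= /andP[pp ps] /andP[pns us]].
  split => // p u pp; rewrite inE => /eqP ->; rewrite dvdn1 => /eqP p1.
  by rewrite p1 in pp.
have [uW W0 Wp] := IH ps us; have p0 := prime_gt0 pp; split.
- rewrite cat_uniq uW map_inj_uniq ?uW ?andbT /=; last first.
    by move=> u v /eqP; rewrite eqn_pmul2l // => /eqP.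
  (* The two halves are disjoint: p divides p u, but divides no product of the remaining primes. *)
  apply/hasPn => _ /mapP[u uin ->]; apply: contra pns => pu.
  by apply: (Wp _ _ pp pu); rewrite dvdn_mulr.
- rewrite all_cat W0 /=; apply/allP => _ /mapP[u uin ->].
  by rewrite muln_gt0 p0 (allP W0).
- move=> q u qp; rewrite mem_cat => /orP[uin qu|/mapP[v vin ->]].
    by rewrite inE (Wp q u) ?orbT.
  rewrite Euclid_dvdM // => /orP[|qv]; last by rewrite inE (Wp q v) ?orbT.
  by rewrite dvdn_prime2 // => /eqP ->; rewrite inE eqxx.
Qed.

Lemma sum_subset_prods (R : realType) (s : seq nat) : all (fun p => 0 < p)%N s ->
  \sum_(u <- subset_prods s) u%:R^-1 = \prod_(p <- s) (1 + p%:R^-1) :> R.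
Proof.
elim: s => [_|p s IH /= /andP[p0 s0]]; first by rewrite big_nil big_seq1 invr1.
rewrite big_cat big_map /= big_cons mulrDl mul1r IH //; congr (_ + _).
by rewrite -IH // mulr_sumr; apply: eq_bigr => u _; rewrite natrM invfM.
Qed.

(** Adjoining p raises the mean of ln u under the weights 1/u by ln p / (p + 1), which is at most ln
    p / p. *)
Lemma sum_ln_subset_prods (R : realType) (s : seq nat) : all prime s -> uniq s ->
  \sum_(u <- subset_prods s) (ln u%:R / u%:R) <=
  \prod_(p <- s) (1 + p%:R^-1) * \sum_(p <- s) (ln p%:R / p%:R) :> R.
Proof.
elim: s => [_ _|p s IH /= /andP[pp ps] /andP[pns us]].
  by rewrite !big_nil big_seq1 ln1 mul0r mul1r.
have [_ W0 _] := subset_prods_prime ps us; have p0 := prime_gt0 pp.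
rewrite big_cat big_map /= !big_cons.
have -> : \sum_(u <- subset_prods s) (ln (p * u)%:R / (p * u)%:R) =
    p%:R^-1 * \sum_(u <- subset_prods s) (ln u%:R / u%:R) +
    ln p%:R / p%:R * \prod_(q <- s) (1 + q%:R^-1) :> R.
  rewrite -sum_subset_prods; last by apply: sub_all ps => q /prime_gt0.
  rewrite !mulr_sumr -big_split /= big_seq [RHS]big_seq; apply: eq_bigr => u uin.
  have u0 := allP W0 _ uin.
  rewrite natrM lnM ?posrE ?ltr0n // invfM; move: (p%:R^-1) (u%:R^-1) (ln _) (ln _) => *; ring.
move: (IH ps us); set P := \prod_(_ <- _) _; set S := \sum_(_ <- _) _; set G := \sum_(_ <- _) _.
have P0 : 0 <= P by apply: prodr_ge0 => q _; rewrite addr_ge0.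
have : 0 <= ln p%:R / p%:R :> R by rewrite divr_ge0 ?ln_nat_ge0.
have : 0 <= p%:R^-1 :> R by [].
move: (p%:R^-1) (ln p%:R / p%:R) => x y x0 y0 H.
(* The slack in the goal is (P G - S) + x (P G - S) + x y P. *)
have h1 : 0 <= x * (P * G - S) by rewrite mulr_ge0 // subr_ge0.
have h2 : 0 <= x * (y * P) by rewrite !mulr_ge0.
nra.
Qed.

(* Under the weights 1/u on the squarefree u with prime factors in [1, X] the mean of ln u
   is at most 2 ln X, so by Markov half of the mass lies on u <= X^4, where the
   harmonic sum bounds it. *)
Lemma prod_1Dprime_le (R : realType) (X : nat) : (2 <= X)%N ->
  \prod_(1 <= p < X.+1 | prime p) (1 + p%:R^-1) <= 12 * ln X%:R :> R.
Proof.
move=> X2; rewrite -big_filter; set s := [seq p <- _ | _].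
have ps : all prime s by apply: filter_all.
have us : uniq s by rewrite filter_uniq // iota_uniq.
have [uW W0 _] := subset_prods_prime ps us.
have s0 : all (fun p => 0 < p)%N s by apply: sub_all ps => q /prime_gt0.
have SPG := sum_ln_subset_prods R ps us; have GX := sum_ln_prime_div_le R X.
rewrite -big_filter -/s in GX; set P := \prod_(_ <- _) _ in SPG *.
have P0 : 0 <= P by apply: prodr_ge0 => q _; rewrite addr_ge0.
have L0 := ln_nat_ge R X2; set L := ln X%:R in GX L0 *.
have Z0 : (0 < X ^ 4)%N by rewrite expn_gt0 (leq_trans _ X2).
have lnZ : ln (X ^ 4)%N%:R = 4 * L :> R.
  by rewrite natrX lnXn ?ltr0n ?(leq_trans _ X2) // mulr_natl.
(* For u > X ^ 4 one has 4 L <= ln u, so those u are charged to the mean of ln u; the others are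
   charged to the harmonic sum. *)
have : 4 * L * P <= 4 * L * (1 + 4 * L) + P * (2 * L).
  have PE : P = \sum_(u <- subset_prods s) u%:R^-1 by rewrite sum_subset_prods.
  rewrite {1}PE mulr_sumr.
  apply: (@le_trans _ _ (\sum_(u <- subset_prods s)
      ((if (u <= X ^ 4)%N then 4 * L * u%:R^-1 else 0) + ln u%:R / u%:R))).
    rewrite big_seq [leRHS]big_seq; apply: ler_sum => u uin.
    have u0 := allP W0 _ uin; case: leqP => [_|uZ].
      by rewrite lerDl divr_ge0 ?ln_nat_ge0.
    rewrite add0r ler_wpM2r ?invr_ge0 // -lnZ.
    by rewrite ler_ln ?posrE ?ltr0n // ler_nat ltnW.
  rewrite big_split /= lerD //; last first.
    by apply: le_trans SPG _; rewrite ler_wpM2l.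
  rewrite -big_mkcond -mulr_sumr ler_wpM2l //; first by rewrite mulr_ge0 //; lra.
  rewrite -lnZ; apply: le_trans (harmonic_le _ _).
  rewrite -big_filter; apply: (@le_trans _ _ (\sum_(i <- index_iota 1 (X ^ 4).+1 |
      i \in [seq x <- subset_prods s | (x <= X ^ 4)%N]) i%:R^-1)); last first.
    by rewrite [leRHS](bigID (mem [seq x <- subset_prods s | (x <= X ^ 4)%N])) /= lerDl sumr_ge0.
  rewrite -[leRHS]big_filter le_eqVlt; apply/orP; left; apply/eqP; apply: perm_big.
  apply: uniq_perm; rewrite ?filter_uniq ?iota_uniq // => i.
  rewrite mem_filter [in RHS]mem_filter mem_index_iota !mem_filter ltnS.
  by case: (boolP (i \in _)) => [/(allP W0) ->|]; rewrite ?andbF // andbT andbb.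
move: L L0 {GX lnZ SPG} P P0 => L L0 P P0 H.
have LL : 0 < L by lra.
(* The inequality gives P <= 2 + 8 L, and 2 <= 4 L because L >= 1/2. *)
suff : 4 * L * P <= 4 * L * (12 * L) by rewrite ler_pM2l //; lra.
nra.
Qed.

(* If a prime p > N / W divides x <= N then the cofactor x / p is less than W; sum
   psi(N / m) over the cofactors m. *)
Lemma cnt_large_prime (R : realType) (P : pred nat) (N W : nat) : (0 < W <= N)%N ->
  (forall x, (0 < x <= N)%N -> P x -> exists p, [/\ prime p, (N < p * W)%N & (p %| x)%N]) ->
  (cnt P N)%:R * ln (N%:R / W%:R) <= 6 * N%:R * (1 + ln W%:R) :> R.
Proof.
move=> /andP[W0 WN] HP; set L := ln _.
have W0' : 0 < W%:R :> R by rewrite ltr0n.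
have N0' : 0 < N%:R :> R by rewrite ltr0n (leq_trans W0).
pose c p : R := if prime p && (N < p * W)%N then ln p%:R else 0.
have c0 p : 0 <= c p by rewrite /c; case: ifP => // _; exact: ln_nat_ge0.
apply: (@le_trans _ _ (\sum_(1 <= x < N.+1) \sum_(1 <= p < N.+1 | (p %| x)%N) c p)).
  rewrite natr_cnt mulr_suml big_mkcond big_nat [leRHS]big_nat.
  apply: ler_sum => x /andP[x0 xN]; case: ifP => [Px|_]; last by rewrite sumr_ge0.
  have xN' : (0 < x <= N)%N by rewrite x0 -ltnS.
  have [p [pp NpW px]] := HP x xN' Px.
  rewrite mul1r big_mkcond (bigD1_seq p) ?iota_uniq //=; last first.
    rewrite mem_index_iota prime_gt0 //= ltnS; apply: leq_trans (dvdn_leq x0 px) _.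
    by rewrite -ltnS.
  rewrite px -[leLHS]addr0 lerD //; last by rewrite sumr_ge0 // => q _; case: ifP.
  rewrite /c pp NpW /= ler_ln ?posrE ?ltr0n ?(prime_gt0 pp) ?divr_gt0 //.
  by rewrite ler_pdivrMr // -natrM ler_nat ltnW.
have -> := sum_sum_dvdn (fun p _ => c p) N.
have -> := hyperbola_exchange (fun p _ => c p) N.
apply: (@le_trans _ _ (\sum_(1 <= m < W.+1) (6 * N%:R) * m%:R^-1)); last first.
  by rewrite -mulr_sumr ler_wpM2l ?mulr_ge0 // harmonic_le.
(* Cofactors m > W contribute nothing: p m <= N is incompatible with N < p W. *)
rewrite (@big_cat_nat _ _ _ W.+1 1 N.+1) //= [X in _ + X]big_nat [X in _ + X]big1; last first.
  move=> m /andP[Wm _]; rewrite big_nat big1 // => p /andP[p1]; rewrite ltnS => pN.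
  rewrite /c; case: ifP => // /andP[_]; rewrite ltnNge => /negP[].
  by rewrite leq_divRL in pN => //; [nia|lia].
rewrite addr0 big_nat [leRHS]big_nat; apply: ler_sum => m /andP[m1 mW].
apply: (@le_trans _ _ (6 * (N %/ m)%:R)); last first.
  by rewrite -mulrA ler_wpM2l // divn_le_div.
apply: le_trans (chebyshev_psi_le _ _); apply: ler_sum => p _.
by rewrite /c; case: ifP => [/andP[pp _]|_]; [exact: ln_le_vonMangoldt|exact: vonMangoldt_ge0].
Qed.

(** * Densities of divisor-closed sets *)

(** Over all integers from 2 to X the product telescopes to the left-hand side; omitting the
    composite factors can only increase it. *)
Lemma prod_1Bprime2_ge (R : realType) (X : nat) : (0 < X)%N ->
  X.+1%:R / (2 * X%:R) <= \prod_(1 <= p < X.+1 | prime p) (1 - p%:R^-1 ^+ 2) :> R.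
Proof.
elim: X => // -[_ _|X IH _].
  by rewrite big_mkcond big_nat1 /= mulr1 divff.
have X1 : 0 < X.+1%:R :> R by [].
set x := X.+1%:R in X1 IH *; have x1 : 1 <= x by rewrite ler1n.
have e1 : X.+2%:R = x + 1 by rewrite natr1.
have e2 : X.+3%:R = x + 2 by rewrite -natr1 e1 -addrA.
apply: (@le_trans _ _ ((X.+2%:R / (2 * x)) * (1 - X.+2%:R^-1 ^+ 2))).
  rewrite e1 e2 le_eqVlt; apply/orP; left; apply/eqP; field.
  have X0 : 0 <= X%:R :> R by [].
  by apply/andP; split; apply: lt0r_neq0; lra.
have f0 : 0 <= 1 - X.+2%:R^-1 ^+ 2 :> R.
  by rewrite subr_ge0 expr_le1 // ?invf_le1 ?ler1n.
have -> : \prod_(1 <= p < X.+3 | prime p) (1 - p%:R^-1 ^+ 2) =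
    \prod_(1 <= p < X.+2 | prime p) (1 - p%:R^-1 ^+ 2) *
    (if prime X.+2 then 1 - X.+2%:R^-1 ^+ 2 else 1) :> R.
  by rewrite big_mkcond big_nat_recr //= [in RHS]big_mkcond.
apply: (@le_trans _ _ (\prod_(1 <= p < X.+2 | prime p) (1 - p%:R^-1 ^+ 2) * (1 - X.+2%:R^-1 ^+ 2))).
  by rewrite ler_wpM2r // IH.
have P0 : 0 <= \prod_(1 <= p < X.+2 | prime p) (1 - p%:R^-1 ^+ 2) :> R.
  apply: le_trans (IH _) => //; by rewrite divr_ge0 // mulr_ge0 // ltW.
apply: ler_wpM2l => //; case: ifP => // _.
Qed.

(** Write 1 - 1/p = (1 - 1/p^2) / (1 + 1/p): the numerators have product at least 1/2 and the
    denominators at most 12 ln X. *)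
Lemma prod_1Bprime_ge (R : realType) (X : nat) : (2 <= X)%N ->
  (24 * ln X%:R)^-1 <= \prod_(1 <= p < X.+1 | prime p) (1 - p%:R^-1) :> R.
Proof.
move=> X2; have X0 : (0 < X)%N by apply: leq_trans X2.
have := prod_1Bprime2_ge R X0; have := prod_1Dprime_le R X2.
set P := \prod_(_ <= _ < _ | _) _; set Q := \prod_(_ <= _ < _ | _) _.
set S := \prod_(_ <= _ < _ | _) _ => PL QX.
have QE : Q = P * S.
  rewrite /Q /P /S -big_split /=; apply: eq_bigr => p _; ring.
have L0 := ln_nat_ge R X2; set L := ln X%:R in PL L0 *.
have S0 : 0 <= S.
  by apply: prodr_ge0 => p /prime_gt1 p1; rewrite subr_ge0 invf_le1 ?ltr0n ?ler1n ltnW.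
have Q2 : 2^-1 <= Q.
  apply: le_trans QX; rewrite invfM mulrCA -[leLHS]mulr1 ler_wpM2l //.
  by rewrite ler_pdivlMr ?ltr0n // mul1r ler_nat.
have L1 : 0 < 24 * L by lra.
rewrite -(ler_pM2l L1) mulfV ?lt0r_neq0 //.
have : P * S <= 12 * L * S by rewrite ler_wpM2r.
rewrite -QE; lra.
Qed.

Lemma totientE_prod (R : realType) (m : nat) : (0 < m)%N ->
  (totient m)%:R = m%:R * \prod_(p <- primes m) (1 - p%:R^-1) :> R.
Proof.
move=> m0; have mE : m%:R = \prod_(p <- primes m) (p ^ logn p m)%:R :> R.
  by rewrite {1}(prod_prime_decomp m0) prime_decompE big_map natr_prod.
rewrite totientE // mE natr_prod -big_split /= big_seq [RHS]big_seq; apply: eq_bigr => p pm.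
have k0 : (0 < logn p m)%N by rewrite logn_gt0.
have p0 : (0 < p)%N by move: pm; rewrite mem_primes => /andP[/prime_gt0].
have -> : (p ^ logn p m = p * p ^ (logn p m).-1)%N by rewrite -expnS prednK.
have p0' : p%:R != 0 :> R by rewrite pnatr_eq0 -lt0n.
rewrite -subn1 !natrM natrB // mulrBr mulr1 mulrAC mulfV // mul1r.
by rewrite mulrBl mul1r.
Qed.

Lemma totient_ge (R : realType) (m X : nat) : (0 < m)%N ->
  (forall p, prime p -> (p %| m)%N -> (p <= X)%N) ->
  m%:R * \prod_(1 <= p < X.+1 | prime p) (1 - p%:R^-1) <= (totient m)%:R :> R.
Proof.
move=> m0 mX; rewrite totientE_prod // ler_wpM2l //.
have -> : \prod_(p <- primes m) (1 - p%:R^-1) =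
    \prod_(1 <= p < X.+1 | p \in primes m) (1 - p%:R^-1) :> R.
  rewrite -[RHS]big_filter; apply: perm_big; apply: uniq_perm.
  - exact: primes_uniq.
  - by rewrite filter_uniq // iota_uniq.
  move=> p; rewrite mem_filter mem_index_iota; case: (boolP (p \in primes m)) => //.
  by rewrite mem_primes ltnS => /and3P[pp _ pm]; rewrite prime_gt0 // mX.
rewrite big_mkcond [leRHS]big_mkcond; apply: ler_prod => p _.
case: (boolP (prime p)) => [pp|npp].
  have p1 : (p%:R^-1 : R) <= 1 by rewrite invf_le1 ?ltr0n ?ler1n prime_gt0.
  by rewrite subr_ge0 p1 /=; case: ifP => // _; rewrite gerBl.
by rewrite mem_primes (negbTE npp) ler01 lexx.
Qed.

Lemma cnt_gcdn (T u : nat) : (0 < T)%N -> (u %| T)%N ->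
  cnt (fun n => gcdn n T == u) T = totient (T %/ u).
Proof.
move=> T0 uT; have u0 := dvdn_gt0 T0 uT; have d0 : (0 < T %/ u)%N by rewrite divn_gt0 // dvdn_leq.
rewrite /cnt (eq_bigl (fun n => (u %| n) && (gcdn n T == u))%N); last first.
  by move=> n /=; case: eqP => [<-|]; rewrite ?andbF // dvdn_gcdl.
rewrite big_mkcondr sum_dvdn // totient_count_coprime.
have -> : (\sum_(1 <= i < (T %/ u).+1) (if gcdn (u * i) T == u then 1 else 0) =
    \sum_(1 <= i < (T %/ u).+1) coprime (T %/ u) i)%N.
  apply: eq_bigr => i _; rewrite -{1}(divnK uT) [X in gcdn _ X]mulnC -muln_gcdr.
  by rewrite -[X in _ == X]muln1 eqn_pmul2l // gcdnC /coprime; case: eqP.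
(* The totient counts residues from 0 to T/u - 1, the sum here runs from 1 to T/u; the two end
   points have the same gcd with T/u. *)
rewrite big_nat_recr //= [RHS]big_ltn //.
by rewrite /coprime gcdn0 gcdnn addnC.
Qed.

(* Sort n <= T by u = gcd(n, T): there are phi(T / u) such n, all in F if u is. *)
Lemma cnt_ge_harmonic (R : realType) (F : pred nat) (X Y T : nat) :
  (2 <= X)%N -> (0 < T)%N ->
  (forall p, prime p -> (p %| T)%N -> (p <= X)%N) ->
  (forall u, (0 < u <= Y)%N -> (u %| T)%N) ->
  (forall m, F (gcdn m T) -> F m) ->
  T%:R * \sum_(1 <= u < Y.+1 | F u) u%:R^-1 <= 24 * ln X%:R * (cnt F T)%:R :> R.
Proof.
move=> X2 T0 TX YT FT.
have L0 : 0 < 24 * ln X%:R :> R by have := ln_nat_ge R X2; lra.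
have : (\sum_(1 <= u < Y.+1 | F u) totient (T %/ u) <= cnt F T)%N.
  rewrite big_nat_cond (eq_bigr (fun u => cnt (fun n => gcdn n T == u) T)); last first.
    by move=> u /andP[uY _]; rewrite cnt_gcdn ?YT.
  rewrite -big_nat_cond (exchange_big_dep_nat xpredT) //= /cnt [leqRHS]big_mkcond /=.
  (* Each n is counted for at most one u, its gcd with T, and then n itself lies in F. *)
  apply: leq_sum => n _; rewrite (eq_bigl (fun u => F u && (u == gcdn n T))); last first.
    by move=> u; rewrite eq_sym.
  case: ifP => Fn; last first.
    rewrite big1 // => u /andP[Fu /eqP uE]; move: Fn; rewrite FT // -uE //.
  apply: (@leq_trans (\sum_(1 <= i < Y.+1 | i == gcdn n T) 1)).
    by rewrite big_mkcond [leqRHS]big_mkcond; apply: leq_sum => u _; case: (F u) => //=; case: eqP.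
  by rewrite big_nat1_eq; case: ifP.
rewrite -(ler_nat R) natr_sum => H.
rewrite -(ler_pM2l L0) in H; apply: le_trans H.
rewrite !mulr_sumr big_nat_cond [leRHS]big_nat_cond; apply: ler_sum => u /andP[uY _].
have [u0 _] := andP uY; have uT := YT u uY.
have d0 : (0 < T %/ u)%N by rewrite divn_gt0 // dvdn_leq.
have := @totient_ge R (T %/ u) X d0 (fun p pp pT => TX p pp (dvdn_trans pT (dvdn_div uT))).
move=> /(ler_wpM2l (ltW L0)); apply: le_trans.
have -> : T%:R / u%:R = (T %/ u)%:R :> R.
  by rewrite -{1}(divnK uT) natrM mulfK // pnatr_eq0 -lt0n.
rewrite mulrCA -[leLHS]mulr1 ler_wpM2l // -ler_pdivrMl // mulr1.
exact: prod_1Bprime_ge.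
Qed.

(** * Multiples sorted by their least divisor *)

Lemma eq_cnt (P Q : pred nat) (N : nat) :
  (forall n, (0 < n <= N)%N -> P n = Q n) -> cnt P N = cnt Q N.
Proof.
move=> PQ; rewrite /cnt big_nat_cond [RHS]big_nat_cond; apply: eq_bigl => n.
by rewrite ltnS; case: (boolP (0 < n <= N)%N) => //= /PQ.
Qed.

Lemma cnt_le (P Q : pred nat) (N : nat) :
  (forall n, (0 < n <= N)%N -> P n -> Q n) -> (cnt P N <= cnt Q N)%N.
Proof.
move=> PQ; rewrite /cnt big_nat_cond [leqRHS]big_nat_cond big_mkcond [leqRHS]big_mkcond /=.
apply: leq_sum => n _; rewrite ltnS; case: (boolP (0 < n <= N)%N) => //= /PQ.
by case: (P n) => //= ->.
Qed.

Lemma cnt_leq (P : pred nat) (N : nat) : (cnt P N <= N)%N.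
Proof.
by rewrite /cnt sum1_count (leq_trans (count_size _ _)) // size_iota subn1.
Qed.

Lemma cntU (P Q : pred nat) (N : nat) :
  (cnt (fun n => P n || Q n) N <= cnt P N + cnt Q N)%N.
Proof.
rewrite /cnt big_mkcond [X in (_ <= X + _)%N]big_mkcond [X in (_ <= _ + X)%N]big_mkcond.
rewrite -big_split /=; apply: leq_sum => n _.
by case: (P n) => //=; case: (Q n).
Qed.

Lemma cnt_split (P Q : pred nat) (N : nat) :
  cnt Q N = (cnt (fun n => Q n && P n) N + cnt (fun n => Q n && ~~ P n) N)%N.
Proof. by rewrite /cnt (bigID P). Qed.

Lemma cnt_addn (P : pred nat) (M N : nat) :
  cnt P (M + N) = (cnt P M + cnt (fun n => P (M + n)%N) N)%N.
Proof.
rewrite /cnt (@big_cat_nat _ _ _ M.+1) //= ?ltnS ?leq_addr //; congr addn.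
rewrite -[M.+1]add1n big_addn -addnS addKn; apply: eq_bigl => n.
by rewrite addnC.
Qed.

Lemma cnt_periodic (P : pred nat) (L k : nat) : (forall n, P (L + n)%N = P n) ->
  cnt P (k * L) = (k * cnt P L)%N.
Proof.
move=> PL; elim: k => [|k IH]; first by rewrite /cnt big_nil.
by rewrite !mulSn cnt_addn; congr addn; rewrite -IH; apply: eq_cnt.
Qed.

(** Complete periods contribute exactly their share; for the rest, the count and its expected value
    both lie in [0, L]. *)
Lemma cnt_periodic_near (R : realType) (P : pred nat) (L N : nat) : (0 < L)%N ->
  (forall n, P (L + n)%N = P n) ->
  `|(cnt P N)%:R - N%:R * ((cnt P L)%:R / L%:R)| <= L%:R :> R.
Proof.
move=> L0 PL; have L0' : 0 < L%:R :> R by rewrite ltr0n.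
have PkL k n : P (k * L + n)%N = P n by elim: k => // k IH; rewrite mulSn -addnA PL.
have -> : cnt P N = (N %/ L * cnt P L + cnt P (N %% L))%N.
  rewrite {1}(divn_eq N L) cnt_addn cnt_periodic //; congr addn.
  by apply: eq_cnt.
have NE : N%:R = (N %/ L)%:R * L%:R + (N %% L)%:R :> R.
  by rewrite -natrM -natrD -divn_eq.
set c := (cnt P L)%:R / L%:R.
have cE : (cnt P L)%:R = c * L%:R by rewrite mulfVK ?lt0r_neq0.
rewrite natrD natrM NE cE.
have -> : (N %/ L)%:R * (c * L%:R) + (cnt P (N %% L))%:R -
    ((N %/ L)%:R * L%:R + (N %% L)%:R) * c = (cnt P (N %% L))%:R - (N %% L)%:R * c by ring.
have rL : (N %% L)%:R <= L%:R :> R by rewrite ler_nat ltnW // ltn_pmod.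
have cr : (cnt P (N %% L))%:R <= (N %% L)%:R :> R by rewrite ler_nat cnt_leq.
have cL : c <= 1 by rewrite ler_pdivrMr // mul1r ler_nat cnt_leq.
have c0 : 0 <= c by rewrite divr_ge0.
have r0 : 0 <= (N %% L)%:R :> R by [].
have cr0 : 0 <= (cnt P (N %% L))%:R :> R by [].
rewrite ler_norml; by apply/andP; split; nra.
Qed.

Lemma prime_dvd_fact (p n : nat) : prime p -> (p %| n`!)%N -> (p <= n)%N.
Proof.
move=> pp; elim: n => [|n IH]; first by rewrite dvdn1 => /eqP p1; rewrite p1 in pp.
rewrite factS Euclid_dvdM // => /orP[/dvdn_leq -> //|/IH]; exact: leqW.
Qed.

Lemma fact_dvd_fact (m n : nat) : (m <= n)%N -> (m`! %| n`!)%N.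
Proof. by move=> mn; rewrite -(bin_fact mn) mulnCA dvdn_mulr. Qed.

Definition mult (B : set nat) (n : nat) : bool := `[< exists2 b, B b & (b %| n)%N >].

Definition trunc (B : set nat) (z : nat) : set nat := B `&` [set b | (b <= z)%N].

Lemma multP (B : set nat) (n : nat) : reflect (exists2 b, B b & (b %| n)%N) (mult B n).
Proof. exact: asboolP. Qed.

Lemma mult_sub (B B' : set nat) (n : nat) : B `<=` B' -> mult B n -> mult B' n.
Proof. by move=> BB' /multP[b Bb bn]; apply/multP; exists b => //; apply: BB'. Qed.

Lemma mult_addn (B : set nat) (T n : nat) : (forall b, B b -> (b %| T)%N) ->
  mult B (T + n) = mult B n.
Proof.
move=> BT; apply/multP/multP => -[b Bb].
  by rewrite dvdn_addr ?BT // => bn; exists b.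
by move=> bn; exists b => //; rewrite dvdn_addr ?BT.
Qed.

(** For positive elements this is the exact density of the multiples of the truncated set, since its
    elements all divide z! and the multiples are thus z!-periodic. *)
Definition finite_density (R : realType) (B : set nat) (z : nat) : R :=
  (cnt (mult (trunc B z)) z`!)%:R / z`!%:R.

Lemma trunc_dvd_fact (B : set nat) (z N b : nat) : B `<=` posn -> (z <= N)%N ->
  trunc B z b -> (b %| N`!)%N.
Proof.
by move=> B0 zN [Bb bz]; rewrite dvdn_fact // (B0 _ Bb) (leq_trans bz).
Qed.

Lemma finite_densityE (R : realType) (B : set nat) (z T : nat) : B `<=` posn ->
  (0 < T)%N -> (z`! %| T)%N ->
  finite_density R B z = (cnt (mult (trunc B z)) T)%:R / T%:R.
Proof.
move=> B0 T0 zT; rewrite /finite_density -(divnK zT) cnt_periodic.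
  have k0 : (T %/ z`!)%:R != 0 :> R.
    by rewrite pnatr_eq0 -lt0n divn_gt0 ?fact_gt0 // dvdn_leq.
  by rewrite !natrM invfM mulrACA mulfV // mul1r.
move=> n; apply: mult_addn => b; exact: trunc_dvd_fact.
Qed.

Lemma finite_density_homo (R : realType) (B : set nat) : B `<=` posn ->
  {homo finite_density R B : m n / (m <= n)%N >-> m <= n}.
Proof.
move=> B0 m n mn; rewrite (@finite_densityE R B m n`!) ?fact_gt0 ?fact_dvd_fact //.
rewrite ler_wpM2r // ler_nat; apply: cnt_le => k _; apply: mult_sub.
by move=> b [Bb bm]; split => //=; apply: leq_trans mn.
Qed.

Lemma finite_density_le1 (R : realType) (B : set nat) (z : nat) : finite_density R B z <= 1.
Proof. by rewrite ler_pdivrMr ?ltr0n ?fact_gt0 // mul1r ler_nat cnt_leq. Qed.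

Lemma finite_density_cvg (R : realType) (B : set nat) : B `<=` posn ->
  cvgn (finite_density R B).
Proof.
move=> B0; apply: nondecreasing_is_cvgn; first exact: finite_density_homo.
by exists 1 => _ [z _ <-]; exact: finite_density_le1.
Qed.

Definition least_mult (B : set nat) (b n : nat) : bool :=
  (b %| n)%N && ~~ mult (B `&` [set c | (c < b)%N]) n.

(** Writing n = b m, the condition on m defines a divisor-closed set [F]. [cnt_divisor_closed]
    bounds its count up to N / b by a sum of reciprocals, which [cnt_ge_harmonic] bounds by its
    density over the period N! / b; 168 = 7 * 24. *)
Lemma cnt_least_mult (R : realType) (B : set nat) (b N V : nat) : B `<=` posn -> B b ->
  (2 <= N)%N -> (0 < V)%N -> (b * V <= N)%N ->
  (cnt (least_mult B b) N)%:R * ln V%:R <=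
  168 * ln N%:R * N%:R * ((cnt (least_mult B b) N`!)%:R / N`!%:R) :> R.
Proof.
move=> B0 Bb N2 V0 bVN; have b0 : (0 < b)%N := B0 _ Bb.
have bN : (b <= N)%N by apply: leq_trans bVN; rewrite leq_pmulr.
pose F m := ~~ mult (B `&` [set c | (c < b)%N]) (b * m).
have cntE M : cnt (least_mult B b) M = cnt F (M %/ b).
  by rewrite /cnt /least_mult big_mkcondr sum_dvdn // [RHS]big_mkcond.
have bT : (b %| N`!)%N by rewrite dvdn_fact // b0.
set Y := (N %/ b)%N; set T := (N`! %/ b)%N.
have T0 : (0 < T)%N by rewrite divn_gt0 // dvdn_leq // fact_gt0.
have bTE : (b * T = N`!)%N by rewrite mulnC divnK.
have VY : (V <= Y)%N by rewrite leq_divRL // mulnC.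
have Y0 : (0 < Y)%N by apply: leq_trans VY.
have := @cnt_divisor_closed R F Y; have := @cnt_ge_harmonic R F N Y T N2 T0.
rewrite !cntE -/Y -/T => H1 H2.
have {}H1 : T%:R * \sum_(1 <= u < Y.+1 | F u) u%:R^-1 <= 24 * ln N%:R * (cnt F T)%:R :> R.
  apply: H1 => [p pp pT|u /andP[u0 uY]|m].
  - by apply: prime_dvd_fact pp _; rewrite -bTE dvdn_mull.
  - rewrite -(dvdn_pmul2l b0) bTE dvdn_fact // muln_gt0 b0 u0 /=.
    by rewrite mulnC -leq_divRL.
  - apply: contra => /multP[c [Bc cb] cbm]; apply/multP; exists c => //.
    rewrite muln_gcdr dvdn_gcd cbm bTE dvdn_fact // (B0 _ Bc) /=.
    exact: leq_trans (ltnW cb) bN.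
have {}H2 : (cnt F Y)%:R * ln Y%:R <= 7 * Y%:R * \sum_(1 <= u < Y.+1 | F u) (u%:R^-1 : R).
  apply: H2 => m n Fn mn; apply: contra Fn; move=> /multP[c Bc cbm]; apply/multP.
  by exists c => //; apply: dvdn_trans cbm _; rewrite dvdn_pmul2l.
have VY' : ln V%:R <= ln Y%:R :> R by rewrite ler_ln ?posrE ?ltr0n // ler_nat.
apply: le_trans (ler_wpM2l _ VY') _ => //; apply: le_trans H2 _.
have T0' : 0 < T%:R :> R by rewrite ltr0n.
have b0' : 0 < b%:R :> R by rewrite ltr0n.
move: H1; set S := \sum_(_ <= _ < _ | _) _; set c := (cnt F T)%:R => H1.
have {}H1 : S <= 24 * ln N%:R * (c / T%:R) by rewrite mulrA ler_pdivlMr // mulrC.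
have H2 : Y%:R * (c / T%:R) <= N%:R * (c / N`!%:R).
  rewrite -bTE natrM invfM mulrCA [leRHS]mulrCA [leRHS]mulrA -mulrA.
  rewrite [leRHS](_ : _ = c * (N%:R / b%:R * T%:R^-1)); last by ring.
  by rewrite ler_wpM2l // ler_wpM2r // divn_le_div.
have L0 : 0 <= 168 * ln N%:R :> R by apply: mulr_ge0; [exact: ler0n|exact: ln_nat_ge0].
rewrite -[leRHS]mulrA; apply: le_trans (ler_wpM2l L0 H2).
have Y7 : 0 <= 7 * Y%:R :> R by [].
apply: le_trans (ler_wpM2l Y7 H1) _; rewrite le_eqVlt; apply/orP; left; apply/eqP; ring.
Qed.

Lemma least_mult_exists (B : set nat) (n : nat) : mult B n ->
  exists2 b, B b & least_mult B b n.
Proof.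
move=> /multP[b Bb bn].
have ex : exists b, `[< B b >] && (b %| n)%N by exists b; rewrite bn andbT; apply/asboolP.
case: (ex_minnP ex) => c /andP[/asboolP Bc cn] cmin; exists c => //.
rewrite /least_mult cn; apply/multP => -[d [Bd dc] dn].
have := cmin d; rewrite dn andbT leqNgt dc => /(_ _)/negP[] //.
exact/asboolP.
Qed.

Lemma least_mult_inj (B : set nat) (b c n : nat) : B b -> B c ->
  least_mult B b n -> least_mult B c n -> b = c.
Proof.
move=> Bb Bc /andP[bn bl] /andP[cn cl]; apply/eqP; rewrite eqn_leq leqNgt [(c <= b)%N]leqNgt.
apply/andP; split.
  by apply: contra bl => cb; apply/multP; exists c.
by apply: contra cl => cb; apply/multP; exists b.
Qed.

Lemma cnt_has (I : eqType) (s : seq I) (P : I -> pred nat) (N : nat) :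
  (cnt (fun n => has (P^~ n) s) N <= \sum_(i <- s) cnt (P i) N)%N.
Proof.
elim: s => [|i s IH]; first by rewrite big_nil /cnt big1.
rewrite big_cons; apply: leq_trans (leq_add (leqnn _) IH); exact: cntU.
Qed.

Lemma sum_cnt_least_mult (B : set nat) (s : seq nat) (Q : pred nat) (N : nat) :
  uniq s -> (forall b, b \in s -> B b) ->
  (forall b n, b \in s -> (0 < n)%N -> least_mult B b n -> Q n) ->
  (\sum_(b <- s) cnt (least_mult B b) N <= cnt Q N)%N.
Proof.
move=> us sB sQ; rewrite /cnt (exchange_big_dep xpredT) //=.
rewrite big_nat_cond [leqRHS]big_nat_cond big_mkcond [leqRHS]big_mkcond /=.
apply: leq_sum => n _; rewrite andbT; case: (boolP (0 < n < N.+1)%N) => //= /andP[n0 _].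
rewrite sum1_count -size_filter.
case E : [seq b <- s | least_mult B b n] => [|b t] //.
have mem c : c \in b :: t -> B c /\ least_mult B c n /\ c \in s.
  by rewrite -E mem_filter => /andP[-> cs]; split => //; exact: sB.
have [Bb [bn bs]] := mem b (mem_head _ _).
rewrite (sQ b n bs n0 bn) /=; case: t E mem => //= c t E mem.
have [|Bc [cn _]] := mem c; first by rewrite !inE eqxx orbT.
have : uniq [:: b, c & t] by rewrite -E filter_uniq.
by rewrite /= inE (least_mult_inj Bb Bc bn cn) eqxx.
Qed.

(* A multiple of B which has no divisor in B up to z either has a divisor b > N / V
   in B, or its least divisor in B lies in (z, N / V]. *)
Lemma cnt_mult_le (R : realType) (B : set nat) (N V k z : nat) : B `<=` posn ->
  (2 <= N)%N -> (N <= V ^ k)%N -> (z <= N)%N ->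
  (cnt (mult B) N)%:R <= (cnt (mult (trunc B z)) N)%:R +
    (cnt (fun x => `[< exists b, [/\ B b, (b %| x)%N & (N < b * V)%N] >]) N)%:R +
    168 * k%:R * N%:R * (finite_density R B N - finite_density R B z).
Proof.
move=> B0 N2 NVk zN; set bad := fun x => _.
have V2 : (2 <= V)%N.
  rewrite ltnNge; apply/negP => V1; move: N2; rewrite ltnNge => /negP[].
  apply: leq_trans NVk _; rewrite -(exp1n k); by case: k => // k; rewrite leq_exp2r.
have V0 : (0 < V)%N by apply: leq_trans V2.
have N0 : (0 < N)%N by apply: leq_trans N2.
pose s := [seq b <- index_iota 1 N.+1 | [&& `[< B b >], (z < b)%N & (b * V <= N)%N]].
have us : uniq s by rewrite filter_uniq // iota_uniq.
have sP b : b \in s -> [/\ B b, (z < b)%N, (b * V <= N)%N & (b <= N)%N].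
  by rewrite mem_filter mem_index_iota ltnS => /andP[/and3P[/asboolP Bb zb bV] /andP[_ bN]].
have sB b : b \in s -> B b by case/sP.
have H1 : (cnt (mult B) N <= cnt (mult (trunc B z)) N + cnt bad N +
    \sum_(b <- s) cnt (least_mult B b) N)%N.
  apply: leq_trans (leq_add (leqnn _) (cnt_has _ _ _)).
  apply: leq_trans (leq_add (cntU _ _ _) (leqnn _)); apply: leq_trans (cntU _ _ _).
  apply: cnt_le => x /andP[x0 xN] xB; have [b Bb bx] := least_mult_exists xB.
  have [bdx _] := andP bx.
  case: (leqP b z) => bz.
    by apply/orP; left; apply/orP; left; apply/multP; exists b.
  case: (ltnP N (b * V)) => bV.
    by apply/orP; left; apply/orP; right; apply/asboolP; exists b.
  apply/orP; right; apply/hasP; exists b => //.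
  rewrite mem_filter mem_index_iota bz bV (B0 _ Bb) ltnS (leq_trans (dvdn_leq x0 bdx)) //.
  by rewrite !andbT; apply/asboolP.
(* Over the full period N! the classes of the b in [s] are disjoint from one another and from the
   multiples of the elements up to z. *)
have H2 : (\sum_(b <- s) cnt (least_mult B b) N`! + cnt (mult (trunc B z)) N`! <=
    cnt (mult (trunc B N)) N`!)%N.
  rewrite [leqRHS](cnt_split (mult (trunc B z))) addnC leq_add //.
    apply: cnt_le => x _ xB; rewrite xB andbT; apply: mult_sub xB => b [Bb bz]; split => //.
    exact: leq_trans bz zN.
  apply: sum_cnt_least_mult us sB _ => b x /sP[Bb zb _ bN] _ /andP[bx bl].
  apply/andP; split; first by apply/multP; exists b.
  apply: contra bl => /multP[c [Bc cz] cx]; apply/multP; exists c => //; split => //.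
  exact: leq_ltn_trans cz zb.
rewrite -(ler_nat R) !natrD in H1; apply: le_trans H1 _; rewrite lerD2l.
rewrite (natr_sum R s predT).
have F0 : 0 < N`!%:R :> R by rewrite ltr0n fact_gt0.
have H3 : \sum_(b <- s) ((cnt (least_mult B b) N`!)%:R / N`!%:R) <=
    finite_density R B N - finite_density R B z :> R.
  rewrite (@finite_densityE R B z N`!) ?fact_gt0 ?fact_dvd_fact // /finite_density.
  rewrite -mulrBl -mulr_suml ler_pM2r ?invr_gt0 // lerBrDr -(natr_sum R s predT) -natrD ler_nat.
  exact: H2.
have C0 : 0 <= 168 * k%:R * N%:R :> R by rewrite -!natrM ler0n.
apply: le_trans (ler_wpM2l C0 H3); rewrite mulr_sumr big_seq [leRHS]big_seq.
apply: ler_sum => b /sP[Bb _ bV _].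
have L0 : 0 < ln V%:R :> R by have := ln_nat_ge R V2; lra.
(* N <= V ^ k gives ln N <= k ln V, so the loss ln N / ln V is at most k. *)
rewrite -(ler_pM2r L0); apply: le_trans (cnt_least_mult R B0 Bb N2 V0 bV) _.
rewrite [leRHS]mulrAC ler_wpM2r ?divr_ge0 // [leRHS]mulrAC ler_wpM2r // -mulrA ler_wpM2l //.
rewrite mulr_natl -lnXn ?ltr0n // -natrX ler_ln ?posrE ?ltr0n ?expn_gt0 ?V0 //.
by rewrite ler_nat.
Qed.

(** * Erdos' criterion *)

(** Holds by computation: divisibility between nonnegative integers reduces to divisibility of
    natural numbers. *)
Lemma natural_density_multiplesE (R : realType) (B : set nat) (n : nat) :
  natural_density_seq R (multiples B) n = n%:R^-1 * (cnt (mult B) n)%:R.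
Proof. by []. Qed.

Theorem erdos_criterion (R : realType) (B : set nat) : B `<=` posn ->
  (forall eta : R, 0 < eta -> exists k N0, forall N, (N0 <= N)%N ->
    exists2 V, (N <= V ^ k)%N &
    (cnt (fun x => `[< exists b, [/\ B b, (b %| x)%N & (N < b * V)%N] >]) N)%:R <= eta * N%:R) ->
  natural_density_seq R (multiples B) @ \oo --> limn (finite_density R B).
Proof.
move=> B0 HB; set d := limn _.
have dz z : finite_density R B z <= d.
  exact: (nondecreasing_cvgn_le (finite_density_homo R B0) (finite_density_cvg B0)).
apply/cvgrPdist_le => eps eps0; have eta0 : 0 < eps / 4 by rewrite divr_gt0.
have [k [N0 HN]] := HB _ eta0; set eta := eps / 4 in eta0 HN.
have K0 : 0 < 168 * k%:R + 1 :> R by rewrite ltr_wpDl // -natrM ler0n.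
(* Only [k], fixed by eta, enters the choice of z, so z can be kept fixed while N grows. The added 1
   covers k = 0. *)
have [z zd] : exists z, d - finite_density R B z <= eta / (168 * k%:R + 1).
  have /cvgrPdist_le/(_ _ (divr_gt0 eta0 K0)) := @finite_density_cvg R B B0.
  move=> [z _ /(_ z (leqnn _)) /= H]; exists z; exact: le_trans (ler_norm _) H.
near=> N.
have N2 : (2 <= N)%N by near: N; exact: nbhs_infty_ge.
have Nz : (z <= N)%N by near: N; exact: nbhs_infty_ge.
have NN0 : (N0 <= N)%N by near: N; exact: nbhs_infty_ge.
have Nf : z`!%:R / eta <= N%:R by near: N; exact: nbhs_infty_ger.
have N0' : 0 < N%:R :> R by rewrite ltr0n (leq_trans _ N2).
have [V NV bad] := HN N NN0.
have up := cnt_mult_le R B0 N2 NV Nz.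
have per : `|(cnt (mult (trunc B z)) N)%:R - N%:R * finite_density R B z| <= z`!%:R :> R.
  apply: cnt_periodic_near; rewrite ?fact_gt0 // => n; apply: mult_addn => b.
  exact: trunc_dvd_fact.
have lo : (cnt (mult (trunc B z)) N)%:R <= (cnt (mult B) N)%:R :> R.
  rewrite ler_nat; apply: cnt_le => x _; apply: mult_sub; exact: subIsetl.
have fN : z`!%:R <= N%:R * eta by rewrite -ler_pdivrMr.
rewrite natural_density_multiplesE.
set c := (cnt (mult B) N)%:R in up lo *.
have main : `|N%:R * d - c| <= N%:R * eps.
  have e4 : eps = 4 * eta by rewrite /eta; field.
  have dzN := dz N; have zd' : (d - finite_density R B z) * (168 * k%:R + 1) <= eta by rewrite -ler_pdivlMr.
  move: per up lo bad; set t := (cnt (mult (trunc B z)) N)%:R; set w := (cnt _ N)%:R.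
  have := dz z; move: (finite_density R B z) zd' {zd} => fz zd' dfz.
  move: (finite_density R B N) dzN => fN' dzN.
  rewrite ler_distl => /andP[p1 p2] up lo bad.
  have k0 : 0 <= k%:R :> R by [].
  have h1 : 168 * k%:R * N%:R * (fN' - fz) <= N%:R * eta.
    apply: (@le_trans _ _ (N%:R * ((d - fz) * (168 * k%:R + 1)))); last by rewrite ler_wpM2l.
    rewrite [leLHS](_ : _ = N%:R * ((fN' - fz) * (168 * k%:R))); last by ring.
    rewrite ler_wpM2l //; nra.
  have h2 : N%:R * (d - fz) <= N%:R * eta.
    by rewrite ler_wpM2l //; nra.
  have h3 : N%:R * fz <= N%:R * d by rewrite ler_wpM2l.
  (* From above three errors of at most eta N occur (periodicity, large divisors, tail of the
     densities), from below two (periodicity and tail). *)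
  by rewrite e4 ler_norml; apply/andP; split; lra.
rewrite -(ler_pM2l N0') -{1}(gtr0_norm N0') -normrM mulrBr mulrA mulfV ?lt0r_neq0 // mul1r.
exact: main.
Unshelve. all: by end_near. Qed.

Lemma nat_root (j N : nat) : (0 < j)%N -> exists V, (V ^ j <= N < V.+1 ^ j)%N.
Proof.
move=> j0; have ex : exists V, (V ^ j <= N)%N by exists 0%N; rewrite exp0n.
have ub V : (V ^ j <= N)%N -> (V <= N)%N.
  by apply: leq_trans; case: V => // V; rewrite -{1}[V.+1]expn1 leq_pexp2l.
case: (ex_maxnP ex ub) => V VN Vmax; exists V; rewrite VN ltnNge.
by apply/negP => /Vmax; rewrite ltnn.
Qed.

(* If e p > N / V with e^e <= p, then e <= V and p > N / V^2. *)
Lemma large_multiples_rare (R : realType) (B : set nat) :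
  (forall b, B b -> exists e p, [/\ b = (e * p)%N, prime p & (e ^ e <= p)%N]) ->
  forall eta : R, 0 < eta -> exists k N0, forall N, (N0 <= N)%N ->
    exists2 V, (N <= V ^ k)%N &
    (cnt (fun x => `[< exists b, [/\ B b, (b %| x)%N & (N < b * V)%N] >]) N)%:R <= eta * N%:R.
Proof.
move=> HB eta eta0.
have [i Hi] : exists i : nat, 24 / eta <= i%:R.
  exists (Num.truncn (24 / eta)).+1; exact/ltW/truncnS_gt.
(* V will be the integer j-th root of N. Then ln N - 2 ln V >= (i + 1) ln V, and i >= 24 / eta beats
   the constant 24 from 6 + 12 ln V <= 24 ln V. N >= j ^ j ensures V >= j >= 3, whence N < (V + 1) ^
   j <= V ^ (2 j). *)
pose j := (i + 3)%N; exists (2 * j)%N, (j ^ j)%N => N jN.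
have j0 : (0 < j)%N by rewrite /j addn3.
have [V /andP[VN NV]] := nat_root N j0.
have jV : (j <= V)%N.
  by rewrite -ltnS -(ltn_exp2r _ _ j0); apply: leq_ltn_trans NV.
have V3 : (3 <= V)%N by apply: leq_trans jV; rewrite /j leq_addl.
exists V.
  rewrite expnM; apply: leq_trans (ltnW NV) _; rewrite leq_exp2r // expnS expn1.
  by apply: (@leq_trans (2 * V)); [lia|rewrite leq_mul // ltnW].
have V0 : (0 < V)%N by apply: leq_trans V3.
have WN : (0 < V ^ 2 <= N)%N.
  by rewrite expn_gt0 V0 /= (leq_trans _ VN) // leq_pexp2l // /j addn3.
have [W0 WN'] := andP WN.
have H := @cnt_large_prime R (fun x => `[< exists b, [/\ B b, (b %| x)%N & (N < b * V)%N] >]) N (V ^ 2) WN.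
have {H} : (cnt (fun x => `[< exists b, [/\ B b, (b %| x)%N & (N < b * V)%N] >]) N)%:R *
    ln (N%:R / (V ^ 2)%N%:R) <= 6 * N%:R * (1 + ln (V ^ 2)%N%:R) :> R.
  apply: H => x /andP[x0 xN] /asboolP[b [Bb bx NbV]].
  have [e [p [be pp ep]]] := HB b Bb.
  have px : (p %| x)%N by apply: dvdn_trans bx; rewrite be dvdn_mull.
  exists p; split => //; have pN : (p <= N)%N by apply: leq_trans xN; apply: dvdn_leq.
  (* Otherwise e > V >= j, and N < (V + 1) ^ j <= e ^ j <= e ^ e <= p contradicts p <= N. *)
  have eV : (e <= V)%N.
    rewrite leqNgt; apply/negP => Ve; have := leq_trans ep pN; rewrite leqNgt => /negP[].
    apply: leq_trans NV _; apply: (@leq_trans (e ^ j)); first by rewrite leq_exp2r.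
    by rewrite leq_pexp2l // ?(leq_trans jV) ?(ltnW Ve) // (leq_trans _ Ve).
  apply: leq_trans NbV _; rewrite be expnS expn1; nia.
set c := (cnt _ N)%:R => H.
have L0 := ln_nat_ge R (leq_trans (leqnSn 2) V3); set L := ln V%:R in L0.
have N0 : 0 < N%:R :> R by rewrite ltr0n; apply: leq_trans WN'.
have lnW : ln (V ^ 2)%N%:R = 2 * L by rewrite natrX lnXn ?ltr0n // mulr_natl.
have lnN : (i%:R + 3) * L <= ln N%:R.
  rewrite -[3]/(3%:R) -natrD -/j mulr_natl -lnXn ?ltr0n // -natrX.
  by rewrite ler_ln ?posrE ?ltr0n ?expn_gt0 ?V0 // ?ler_nat // (leq_trans W0).
have W0' : 0 < (V ^ 2)%N%:R :> R by rewrite ltr0n.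
rewrite (ln_div N0 W0') lnW in H.
have c0 : 0 <= c by [].
have i0 : 0 <= i%:R :> R by [].
have LL : 0 < L by lra.
have h : c * ((i%:R + 1) * L) <= N%:R * 24 * L.
  apply: (@le_trans _ _ (c * (ln N%:R - 2 * L))).
    by apply: ler_wpM2l => //; lra.
  apply: le_trans H _; rewrite [leLHS](_ : _ = N%:R * (6 + 12 * L)); last by ring.
  by rewrite -[leRHS]mulrA ler_pM2l //; lra.
rewrite mulrA ler_pM2r // in h.
rewrite ler_pdivrMr // in Hi.
suff : c * i%:R <= eta * N%:R * i%:R.
  have [i00|i1] := eqVneq i 0%N; last by rewrite ler_pM2r // ltr0n lt0n.
  by move: Hi; rewrite i00 mul0r; lra.
apply: (@le_trans _ _ (N%:R * 24)); first by apply: le_trans h; rewrite ler_wpM2l //; lra.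
rewrite [leRHS](_ : _ = N%:R * (i%:R * eta)); last by ring.
by rewrite ler_pM2l.
Qed.

(** * The set B^* *)

(** Each of the finitely many primes dividing s divides at most one element of [A]. *)
Lemma infinite_pairwise_coprime (A : set nat) (s : nat) : (0 < s)%N ->
  infinite_set A -> pairwise_coprime A -> exists2 a, A a & coprime a s.
Proof.
move=> s0 infA copA; apply: contrapT => noa; apply: infA.
apply: (@sub_finite_set _ _ (\bigcup_(p in [set` primes s]) (A `&` [set a | (p %| a)%N]))).
  move=> a Aa; have ncop : gcdn a s != 1%N by apply/negP => h; apply: noa; exists a.
  have g0 : (0 < gcdn a s)%N by rewrite gcdn_gt0 s0 orbT.
  have pp : prime (pdiv (gcdn a s)) by rewrite pdiv_prime // ltn_neqAle eq_sym ncop.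
  exists (pdiv (gcdn a s)); rewrite /= ?mem_primes ?pp ?s0 /=.
    exact: dvdn_trans (pdiv_dvd _) (dvdn_gcdr _ _).
  by split => //=; exact: dvdn_trans (pdiv_dvd _) (dvdn_gcdl _ _).
apply: bigcup_finite => // p; rewrite /= mem_primes => /andP[pp _].
have [[a [Aa pa]]|none] := pselect (exists a, A a /\ (p %| a)%N).
  apply: (@sub_finite_set _ _ [set a]) => // b [Ab /= pb].
  apply: contrapT => ba; have /eqP g1 := copA _ _ Ab Aa ba.
  have : (p %| 1)%N by rewrite -g1 dvdn_gcd pb pa.
  by rewrite dvdn1 => /eqP p1; rewrite p1 in pp.
by apply: (@sub_finite_set _ _ set0) => // b [Ab /= pb]; apply: none; exists b.
Qed.

(* If d were in F_E then so would be d + sZ for some s; but for a in A prime to s this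
   progression contains a multiple of d * a. *)
Lemma coprime_divisors_multiples (E B : set nat) (d : nat) : minimal E ->
  (forall b, B b -> mult E b) -> coprime_divisors B d -> mult E d.
Proof.
move=> [_ minE] BE [d0 [A [Apos infA copA dAB]]].
have [s s0 [sM|sF]] := minE d%:Z.
  by have [e Ee /= ed] := sM d%:Z erefl; apply/multP; exists e.
have [a Aa as1] := infinite_pairwise_coprime s0 infA copA.
have /multP[e Ee eda] : mult E (d * a) by apply: BE; apply: dAB; exists a.
(* With c = 0 mod a and c = 1 mod s, d c lies in d + sZ and is a multiple of d a. *)
exfalso; set c := chinese a s 0 1.
have ac : (a %| c)%N by rewrite /dvdn (chinese_modl as1) mod0n.
have /sF : progression d%:Z s (d * c)%N.
  rewrite /progression /= !modz_nat; congr Posz.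
  by rewrite -modnMmr (chinese_modr as1) modnMmr muln1.
apply; exists e => //=.
have edc : (e %| d * c)%N by apply: dvdn_trans eda _; rewrite dvdn_mul.
exact: edc.
Qed.

(** The union of [B] and D(B) contains [E] and consists of multiples of elements of [E]; as [E] is
    primitive, it is the primitive part. *)
Lemma star_eq (E B : set nat) : E `<=` posn -> minimal E -> B `<=` posn ->
  (forall b, B b -> mult E b) -> E `<=` coprime_divisors B -> star B = E.
Proof.
move=> E0 minE B0 BE ED; have [primE _] := minE.
have UE x : (B `|` coprime_divisors B) x -> (0 < x)%N /\ mult E x.
  move=> [Bx|Dx]; first by split; [exact: B0|exact: BE].
  by split; [case: Dx|exact: coprime_divisors_multiples minE BE Dx].
rewrite /star /prim; apply/seteqP; split => [x [Ux nx]|x Ex].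
  have [x0 /multP[e Ee /dvdnP[k xE]]] := UE x Ux.
  case: k xE => [|[|k]] xE; first by rewrite xE in x0.
    by rewrite xE mul1n.
  by exfalso; apply: nx; exists k.+2 => //; exists e => //; right; exact: ED.
split; first by right; exact: ED.
move=> [k /= k2 [c Uc xE]]; have [c0 /multP[e Ee ec]] := UE c Uc.
have ex : e = x by apply: primE => //; rewrite -xE dvdn_mull.
have := dvdn_leq c0 ec; rewrite ex -xE leqNgt => /negP[].
by rewrite -[X in (X < _)%N]mul1n ltn_pmul2r.
Qed.

(** * Tautness *)

(* No coprimality is needed: among the n <= T avoiding the other elements of Q, those
   divisible by q are n = q m with m <= T / q avoiding them too, so they are at most a
   proportion 1 / q of the total. *)
Lemma cnt_sieve_ge (R : realType) (Q : seq nat) (T : nat) : all (fun q => 0 < q)%N Q ->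
  (0 < T)%N -> (\prod_(q <- Q) q %| T)%N ->
  T%:R * \prod_(q <- Q) (1 - q%:R^-1) <= (cnt (fun n => all (fun q => ~~ (q %| n)) Q)%N T)%:R :> R.
Proof.
elim: Q T => [T _ T0 _|q Q IH T /= /andP[q0 Q0] T0].
  by rewrite big_nil mulr1 /cnt /= sum_nat_const_nat subn1 muln1.
rewrite !big_cons => qT; pose F n := all (fun q => ~~ (q %| n))%N Q.
have qT' : (q %| T)%N by apply: dvdn_trans qT; rewrite dvdn_mulr.
have QT : (\prod_(q <- Q) q %| T %/ q)%N.
  by rewrite -(dvdn_pmul2l q0) [X in (_ %| X)%N]mulnC divnK.
have QT' : (\prod_(q <- Q) q %| T)%N by apply: dvdn_trans qT; rewrite dvdn_mull.
have per n : F (T %/ q + n)%N = F n.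
  apply: eq_in_all => r rQ; rewrite dvdn_addr //; apply: dvdn_trans QT.
  by rewrite (big_rem r) //= dvdn_mulr.
have cF : cnt F T = (q * cnt F (T %/ q))%N.
  by rewrite -[T in LHS](divnK qT') mulnC cnt_periodic.
have cq : (cnt (fun n => F n && (q %| n)) T <= cnt F (T %/ q))%N.
  rewrite /cnt; under eq_bigl do rewrite andbC; rewrite big_mkcondr sum_dvdn // -big_mkcond.
  apply: cnt_le => n _; apply: sub_all => r; apply: contra => rn.
  exact: dvdn_mull.
have := cnt_split (fun n => q %| n)%N F T => cE.
have q0' : q%:R != 0 :> R by rewrite pnatr_eq0 -lt0n.
have -> : cnt (fun n => ~~ (q %| n) && all (fun q => ~~ (q %| n)) Q)%N T =
   cnt (fun n => F n && ~~ (q %| n))%N T by apply: eq_cnt => n _; rewrite andbC.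
have cR : (cnt (fun n => F n && (q %| n))%N T)%:R <= (cnt F T)%:R / q%:R :> R.
  by rewrite cF natrM mulrAC mulfV // mul1r ler_nat.
have {}IH := IH T Q0 T0 QT'; rewrite -/(F _) in IH.
have cER : (cnt F T)%:R = (cnt (fun n => F n && (q %| n))%N T)%:R +
  (cnt (fun n => F n && ~~ (q %| n))%N T)%:R :> R by rewrite -natrD -cE.
apply: (@le_trans _ _ ((1 - q%:R^-1) * (cnt F T)%:R)).
  by rewrite mulrCA ler_wpM2l // subr_ge0 invf_le1 ?ltr0n ?ler1n.
rewrite mulrBl mul1r [_^-1 * _]mulrC; lra.
Qed.

(** Factorwise, 1 - x >= exp(-2x) for 0 <= x <= 1/2, because exp(2x) >= 1 + 2x and (1 - x)(1 + 2x)
    >= 1. *)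
Lemma prod_1B_ge_expR (R : realType) (Q : seq nat) : all (fun q => 2 <= q)%N Q ->
  expR (- 2 * \sum_(q <- Q) q%:R^-1) <= \prod_(q <- Q) (1 - q%:R^-1) :> R.
Proof.
elim: Q => [_|q Q IH /= /andP[q2 Q2]]; first by rewrite !big_nil mulr0 expR0.
rewrite !big_cons mulrDr expRD; apply: ler_pM; rewrite ?expR_ge0 ?IH //.
have q0 : 0 < q%:R :> R by rewrite ltr0n (leq_trans _ q2).
have x0 : 0 < q%:R^-1 :> R by rewrite invr_gt0.
have x2 : q%:R^-1 <= 2^-1 :> R by rewrite lef_pV2 ?posrE // ler_nat.
move: (q%:R^-1) x0 x2 => x x0 x2.
have E0 := expR_gt0 (2 * x); have E1 := expR_ge1Dx (2 * x).
rewrite mulNr expRN -(ler_pM2r E0) mulVf ?lt0r_neq0 //.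
have : (1 - x) * (1 + 2 * x) <= (1 - x) * expR (2 * x) by rewrite ler_wpM2l //; lra.
apply: le_trans; nra.
Qed.

(** Thinness through finite sums, which keeps the sieve estimates within the reals. *)
Definition bounded_reciprocals (R : realType) (B : set nat) : Prop :=
  exists M : R, forall s : seq nat, uniq s -> (forall b, b \in s -> B b) ->
    \sum_(b <- s) b%:R^-1 <= M.

Lemma thin_bounded_reciprocals (R : realType) (B : set nat) :
  thin R B -> bounded_reciprocals R B.
Proof.
move=> thB; exists (fine (\esum_(b in B) (b%:R^-1 : R)%:E)%E) => s us sB.
have e0 : (0 <= \esum_(b in B) (b%:R^-1 : R)%:E)%E by apply: esum_ge0 => b _; rewrite lee_fin.
rewrite -lee_fin fineK ?ge0_fin_numE //; apply: ereal_sup_ubound.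
exists [set` s]; first by split; [exact: finite_seq|exact: sB].
by rewrite -fsbig_seq // sumEFin.
Qed.

Lemma finite_density_gap (R : realType) (B : set nat) (b : nat) : B `<=` posn ->
  primitive B -> bounded_reciprocals R B -> B b ->
  exists2 c : R, 0 < c & forall z, (b <= z)%N ->
    c <= finite_density R B z - finite_density R (B `\ b) z.
Proof.
move=> B0 primB [M HM] Bb.
have b0 : (0 < b)%N := B0 _ Bb; have b0' : 0 < b%:R :> R by rewrite ltr0n.
(* The factor 1 / b is the density of the multiples of b. The sieve moduli q satisfy 1/q <= b/c, so
   their reciprocals sum to at most b M, uniformly in z. *)
exists (expR (- 2 * (b%:R * M)) / b%:R); first by rewrite divr_gt0 // expR_gt0.
move=> z bz; pose s := [seq c <- index_iota 1 z.+1 | `[< (B `\ b) c >]].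
have us : uniq s by rewrite filter_uniq // iota_uniq.
have sP c : c \in s -> [/\ B c, c <> b & (c <= z)%N].
  by rewrite mem_filter mem_index_iota ltnS => /andP[/asboolP[Bc cb] /andP[_ cz]].
have sM : \sum_(c <- s) c%:R^-1 <= M by apply: HM => // c /sP[].
pose q c := (c %/ gcdn c b)%N; pose Q := map q s.
have gc c : c \in s -> (0 < gcdn c b)%N by move=> _; rewrite gcdn_gt0 b0 orbT.
have qE c : (q c * gcdn c b)%N = c by rewrite divnK // dvdn_gcdl.
have Q2 : all (fun x => 2 <= x)%N Q.
  (* A modulus equal to 1 would mean that c divides b, which primitivity excludes. *)
  apply/allP => _ /mapP[c cs ->]; have [Bc cb _] := sP c cs.
  have c0 := B0 _ Bc; case E : (q c) => [|[|//]].
    by move: c0; rewrite /posn /= -(qE c) E.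
  exfalso; apply: cb; apply: primB => //.
  by rewrite -{1}(qE c) E mul1n dvdn_gcdr.
have Q0 : all (fun x => 0 < x)%N Q by apply: sub_all Q2 => x; apply: leq_trans.
have P0 : (0 < \prod_(x <- Q) x)%N.
  by rewrite big_seq; apply: prodn_cond_gt0 => x xQ; exact: (allP Q0).
(* T is a period for both truncated sets, and T / b is divisible by the product of the moduli, as
   the sieve requires. *)
pose T := (z`! * (b * \prod_(x <- Q) x))%N.
have T0 : (0 < T)%N by rewrite !muln_gt0 fact_gt0 b0.
have T0' : 0 < T%:R :> R by rewrite ltr0n.
have zT : (z`! %| T)%N by rewrite dvdn_mulr.
have bT : (b %| T)%N by rewrite /T mulnCA dvdn_mulr.
have TbE : (T %/ b = z`! * \prod_(x <- Q) x)%N by rewrite /T mulnCA mulKn.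
have Bb0 : B `\ b `<=` posn by move=> c [/B0].
rewrite (finite_densityE R B0 T0 zT) (finite_densityE R Bb0 T0 zT).
rewrite -mulrBl ler_pdivlMr // mulrAC ler_pdivrMr //.
have sub n : mult (trunc (B `\ b) z) n -> mult (trunc B z) n.
  by apply: mult_sub => c [[Bc _] cz].
have gap : (cnt (fun n => all (fun x => ~~ (x %| n)) Q)%N (T %/ b) <=
    cnt (mult (trunc B z)) T - cnt (mult (trunc (B `\ b) z)) T)%N.
  rewrite (cnt_split (mult (trunc (B `\ b) z)) (mult (trunc B z))).
  rewrite [X in (X + _ - _)%N](@eq_cnt _ (mult (trunc (B `\ b) z))); last first.
    by move=> n _ /=; apply/andP/idP => [[]//|h]; rewrite h sub.
  rewrite addKn.
  apply: (@leq_trans (cnt (fun n => (b %| n) && ~~ mult (trunc (B `\ b) z) n)%N T)).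
    rewrite [leqRHS]/cnt big_mkcondr sum_dvdn // -big_mkcond; apply: cnt_le => n n0 /allP Qn.
    apply/multP => -[c [[Bc cb] cz] cbn].
    have cs : c \in s.
      rewrite mem_filter mem_index_iota ltnS cz (B0 _ Bc) !andbT; exact/asboolP.
    have /negP := Qn _ (map_f q cs); apply.
    have g0 := gc c cs.
    (* c divides both c n and b n, hence gcd(c, b) n, so that q c divides n. *)
    rewrite -(dvdn_pmul2r g0) qE mulnC muln_gcdl dvdn_gcd cbn andbT.
    exact: dvdn_mulr.
  apply: cnt_le => n _ /andP[bn ->]; rewrite andbT; apply/multP; exists b => //.
have le1 : (cnt (mult (trunc (B `\ b) z)) T <= cnt (mult (trunc B z)) T)%N.
  by apply: cnt_le => n _; exact: sub.
rewrite -(ler_nat R) natrB // in gap.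
apply: (@le_trans _ _ ((cnt (fun n => all (fun x => ~~ (x %| n)) Q)%N (T %/ b))%:R * b%:R)).
  have Tb0 : (0 < T %/ b)%N by rewrite TbE muln_gt0 fact_gt0.
  have PT : (\prod_(x <- Q) x %| T %/ b)%N by rewrite TbE dvdn_mull.
  have := @cnt_sieve_ge R Q (T %/ b) Q0 Tb0 PT.
  move=> /(ler_wpM2r (ltW b0')); apply: le_trans.
  rewrite mulrAC -natrM divnK // mulrC ler_wpM2l //.
  apply: le_trans (prod_1B_ge_expR R Q2); rewrite ler_expR.
  rewrite ler_nM2l ?oppr_lt0 //; apply: (@le_trans _ _ (b%:R * \sum_(c <- s) c%:R^-1)); last first.
    by rewrite ler_wpM2l // ltW.
  rewrite /Q big_map mulr_sumr big_seq [leRHS]big_seq; apply: ler_sum => c cs.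
  have g0 := gc c cs; have [Bc _ _] := sP c cs.
  have q0 : (0 < q c)%N by apply: (allP Q0); exact: map_f.
  rewrite -{2}(qE c) natrM invfM mulrCA -[leLHS]mulr1 ler_wpM2l //.
  by rewrite ler_pdivlMr ?ltr0n // mul1r ler_nat dvdn_leq // dvdn_gcdr.
by rewrite ler_wpM2r // ltW.
Qed.

(* Abel summation: with r n the excess of A over d n in [1, n], the difference
   sum_(k <= n) (1_A(k) - d) / k - r n / n has increments r n / (n (n + 1)). *)
Lemma log_density_cvg (R : realType) (A : set int) (d : R) :
  natural_density_seq R A @ \oo --> d -> log_density_seq R A @ \oo --> d.
Proof.
move=> Ad; pose chi k : R := (k%:Z \in A)%:R.
pose r n := \sum_(1 <= k < n.+1) (chi k - d).
pose E n := \sum_(1 <= k < n.+1) (chi k - d) / k%:R.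
pose G n := E n - r n / n%:R.
have rE n : (0 < n)%N -> r n = n%:R * (natural_density_seq R A n - d).
  move=> n0; rewrite /natural_density_seq mulrBr mulVKf ?pnatr_eq0 -?lt0n //.
  rewrite /r sumrB sumr_const_nat subn1 mulr_natl natr_sum [in RHS]big_mkcond.
  by congr (_ - _); apply: eq_bigr => k _; rewrite /chi; case: (_ \in A).
have GS n : (0 < n)%N -> G n.+1 = G n + r n / (n%:R * n.+1%:R).
  move=> n0; have n0' : n%:R != 0 :> R by rewrite pnatr_eq0 -lt0n.
  have rS : r n.+1 = r n + (chi n.+1 - d) by rewrite /r big_nat_recr.
  have ES : E n.+1 = E n + (chi n.+1 - d) / n.+1%:R by rewrite /E big_nat_recr.
  rewrite /G rS ES.
  have -> : n.+1%:R = n%:R + 1 :> R by rewrite natr1.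
  have n1' : n%:R + 1 != 0 :> R by rewrite natr1.
  by field; rewrite n0' n1'.
apply/cvgrPdist_le => eps eps0; set eta := eps / 4.
have eta0 : 0 < eta by rewrite divr_gt0.
have [n0 _ Hn0] : \forall n \near \oo, `|d - natural_density_seq R A n| <= eta.
  by move/cvgrPdist_le : Ad; apply.
have rle n : (n0 < n)%N -> `|r n| <= eta * n%:R.
  move=> nn; rewrite rE ?(leq_ltn_trans _ nn) // normrM normr_nat mulrC distrC.
  by rewrite ler_wpM2r // Hn0 //= ltnW.
(* Past n0 the increment of [G] from m to m + 1 is at most eta / (m + 1) in absolute value. *)
have Gle n : `|G (n0.+1 + n)%N| <= `|G n0.+1| + eta * \sum_(1 <= k < (n0.+1 + n).+1) k%:R^-1.
  elim: n => [|n IH].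
    by rewrite addn0 lerDl mulr_ge0 ?(ltW eta0) // sumr_ge0.
  have m0 : (n0 < n0.+1 + n)%N by rewrite leq_addr.
  rewrite addnS; set m := (n0.+1 + n)%N in IH m0 *.
  have mp : (0 < m)%N by apply: leq_ltn_trans m0.
  have hS : \sum_(1 <= k < m.+2) k%:R^-1 = \sum_(1 <= k < m.+1) k%:R^-1 + m.+1%:R^-1 :> R.
    by rewrite big_nat_recr.
  rewrite GS // hS (mulrDr eta) addrA; apply: le_trans (ler_normD _ _) _.
  apply: lerD IH _; rewrite normrM normfV normrM !normr_nat.
  have mp' : 0 < m%:R :> R by rewrite ltr0n.
  rewrite invfM mulrA ler_wpM2r // ler_pdivrMr //; exact: rle.
near=> n.
have n1 : (n0 < n)%N by near: n; exact: nbhs_infty_gt.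
have np : (0 < n)%N by apply: leq_ltn_trans n1.
(* For such n the quantity eta ln n absorbs every bounded error: the initial value of [G], r n / n,
   and the gap of at most 1 between ln n and the harmonic sum. *)
have lnbig : expR ((`|G n0.+1| + 2 * eta + `|d| + 1) / eta) <= n%:R.
  by near: n; exact: nbhs_infty_ger.
have n0' : 0 < n%:R :> R by rewrite ltr0n.
have {lnbig} Lbig : `|G n0.+1| + 2 * eta + `|d| + 1 <= eta * ln n%:R.
  by rewrite [leRHS]mulrC -ler_pdivrMr // -[leLHS]expRK ler_ln ?posrE ?expR_gt0.
have d0 : 0 <= `|d| by []. have g0 : 0 <= `|G n0.+1| by [].
have L0 : 0 < ln n%:R :> R by rewrite -(pmulr_rgt0 _ eta0); lra.
have hle := harmonic_le R n.
have hge : ln n%:R <= \sum_(1 <= k < n.+1) k%:R^-1 :> R.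
  by apply: le_trans (ln_le_harmonic R n); rewrite ler_ln ?posrE ?ltr0n // ler_nat.
have {Gle} := Gle (n - n0.+1)%N; rewrite subnKC // => Gle.
have rn : `|r n / n%:R| <= eta by rewrite normrM normfV normr_nat ler_pdivrMr // rle.
have sE : \sum_(1 <= k < n.+1 | k%:Z \in A) k%:R^-1 =
    E n + d * \sum_(1 <= k < n.+1) k%:R^-1 :> R.
  rewrite /E mulr_sumr -big_split /= big_mkcond; apply: eq_bigr => k _.
  by rewrite -mulrDl subrK /chi; case: (_ \in A); rewrite ?mul1r ?mul0r.
rewrite /log_density_seq sE -(ler_pM2l L0) -{1}(gtr0_norm L0) -normrM mulrBr mulrA mulfV ?lt0r_neq0 // mul1r.
have EG : E n = G n + r n / n%:R by rewrite /G subrK.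
rewrite EG; move: (G n) (r n / n%:R) (\sum_(1 <= k < n.+1) k%:R^-1) (ln n%:R) L0 Lbig hle hge Gle rn.
move=> g x h L L0 Lbig hle hge Gle rn.
have dh : `|d * (L - h)| <= `|d|.
  rewrite normrM -[leRHS]mulr1 ler_wpM2l // ler_norml; apply/andP; split; lra.
have -> : L * d - (g + x + d * h) = d * (L - h) - g - x by ring.
apply: le_trans (ler_normB _ _) _; apply: le_trans (lerD (ler_normB _ _) (lexx _)) _.
have eh : eta * h <= eta * (1 + L) by rewrite ler_wpM2l // ltW.
have -> : L * eps = 4 * (eta * L) by rewrite /eta; field.
lra.
Unshelve. all: by end_near. Qed.

(* The class i is recovered as the 2-adic valuation of p - 1. *)
Lemma primes_in_class_inj (i j p : nat) :
  primes_in_class i p -> primes_in_class j p -> i = j.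
Proof.
wlog ij : i j / (i <= j)%N.
  by move=> H pi pj; case: (leqP i j) => [|/ltnW] ij; [exact: H|symmetry; exact: H].
move=> [pp pi] [_ pj]; apply/eqP; rewrite eqn_leq ij leqNgt; apply/negP => {}ij.
have p1 : p.-1.+1 = p by rewrite prednK // prime_gt0.
have H k : progression (2 ^ k + 1)%N (2 ^ k.+1)%N p -> p.-1 = 2 ^ k %[mod 2 ^ k.+1].
  rewrite /progression /= !modz_nat => -[] /eqP.
  by rewrite -{1}p1 -addn1 eqn_modDr => /eqP.
have dj : (2 ^ i.+1 %| p.-1)%N.
  apply: (@dvdn_trans (2 ^ j)); first exact: dvdn_exp2l.
  rewrite /dvdn -(modn_dvdm _ (dvdn_exp2l 2 (leqnSn j))) (H j pj).
  by rewrite modn_dvdm ?dvdn_exp2l // modnn.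
have := H i pi; rewrite (eqP dj) modn_small ?ltn_exp2l // => /esym/eqP.
by rewrite expn_eq0.
Qed.

(** The shape of the elements survives the removal of b, so Erdos' criterion evaluates both
    logarithmic densities as limits of finite densities, and a gap uniform in z persists in the
    limit. *)
Lemma taut_of_rare_large_multiples (R : realType) (B : set nat) : B `<=` posn ->
  (forall b, B b -> exists e p, [/\ b = (e * p)%N, prime p & (e ^ e <= p)%N]) ->
  primitive B -> bounded_reciprocals R B -> taut R B.
Proof.
move=> B0 Bep primB bB b Bb.
have Bb0 : B `\ b `<=` posn by move=> c [/B0].
have Bbep c : (B `\ b) c -> exists e p, [/\ c = (e * p)%N, prime p & (e ^ e <= p)%N].
  by case=> /Bep.
have log C : C `<=` posn ->
    (forall c, C c -> exists e p, [/\ c = (e * p)%N, prime p & (e ^ e <= p)%N]) ->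
    log_density R (multiples C) = limn (finite_density R C).
  move=> C0 Cep; apply/cvg_lim => //; apply: log_density_cvg; apply: erdos_criterion => //.
  exact: large_multiples_rare.
rewrite !log //; have [c c0 gap] := finite_density_gap B0 primB bB Bb.
apply: (@le_lt_trans _ _ (limn (finite_density R B) - c)); last by rewrite ltrBlDr ltrDl.
apply: limr_le; first exact: finite_density_cvg.
near=> z; rewrite lerBrDr -lerBrDl; have bz : (b <= z)%N by near: z; exact: nbhs_infty_ge.
apply: le_trans (gap z bz) _; rewrite lerD2r.
exact: (nondecreasing_cvgn_le (finite_density_homo R B0) (finite_density_cvg B0)).
Unshelve. all: by end_near. Qed.

(** * Dilated sets of primes *)

(** Stands in for a maximum of e_1, ..., e_i; the successor makes the bound strict and positive. *)
Definition prefix_sum (e : nat -> nat) (i : nat) : nat := (\sum_(1 <= l < i.+1) e l).+1.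

Lemma lt_prefix_sum (e : nat -> nat) (l i : nat) : (1 <= l <= i)%N ->
  (e l < prefix_sum e i)%N.
Proof.
move=> /andP[l1 li]; rewrite ltnS (bigD1_seq l) ?iota_uniq //= ?leq_addr //.
by rewrite mem_index_iota l1 ltnS.
Qed.

(** Let e_i p divide e_j q. If p = q then i = j, the classes being disjoint. Otherwise p divides
    e_j, so j > i and q > e_i; hence q is prime to e_i p, which then divides e_j. Primitivity of the
    e_i gives e_i = e_j, impossible as p > 1. *)
Lemma dilated_primes_primitive (e : nat -> nat) (A : nat -> set nat) :
  (forall i, (1 <= i)%N -> posn (e i)) ->
  primitive (\bigcup_(i in [set i | (1 <= i)%N]) [set e i]) ->
  (forall i p, (1 <= i)%N -> A i p -> primes_in_class i p) ->
  (forall i l p, (1 <= l <= i)%N -> A i p -> (e l < p)%N) ->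
  primitive (\bigcup_(i in [set i | (1 <= i)%N]) dilate (e i) (A i)).
Proof.
move=> e0 primE AP Ae _ _ [i i1 [p Ap <-]] [j j1 [q Aq <-]] /= pq.
have pp : prime p by case: (AP i p i1 Ap).
have pr : prime q by case: (AP j q j1 Aq).
have ei0 := e0 i i1; have ej0 := e0 j j1.
have [pqE|npq] := eqVneq p q.
  suff -> : i = j by rewrite pqE.
  by apply: primes_in_class_inj (AP i p i1 Ap) _; rewrite pqE; exact: AP.
have pej : (p %| e j)%N.
  have : (p %| e j * q)%N by apply: dvdn_trans pq; rewrite dvdn_mull.
  by rewrite Euclid_dvdM // [(p %| q)%N]dvdn_prime2 // (negbTE npq) orbF.
have pej' := dvdn_leq ej0 pej; case: (leqP j i) => ij.
  by have := Ae i j p; rewrite j1 ij ltnNge pej' => /(_ isT Ap).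
have eiq : (e i < q)%N by apply: (Ae j i) => //; rewrite i1 ltnW.
have cop : coprime (e i * p) q.
  rewrite coprime_sym prime_coprime // Euclid_dvdM // negb_or.
  by rewrite [(q %| p)%N]dvdn_prime2 // eq_sym npq andbT gtnNdvd.
have {pq} eipej : (e i * p %| e j)%N by rewrite -(Gauss_dvdl _ cop).
have eij : e i = e j.
  by apply: primE; [exists i|exists j|exact: dvdn_trans (dvdn_mulr _ (dvdnn _)) eipej].
have := dvdn_leq ej0 eipej; rewrite -eij -[leqRHS]muln1 leq_pmul2l //.
by rewrite leqNgt prime_gt1.
Qed.

(* The primes p of the elements e_i p are distinct since the classes are disjoint. *)
Lemma dilated_primes_bounded_reciprocals (R : realType) (e : nat -> nat) (A : nat -> set nat) :
  (forall i, (1 <= i)%N -> posn (e i)) ->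
  (forall i p, (1 <= i)%N -> A i p -> primes_in_class i p) ->
  bounded_reciprocals R (\bigcup_(i in [set i | (1 <= i)%N]) A i) ->
  bounded_reciprocals R (\bigcup_(i in [set i | (1 <= i)%N]) dilate (e i) (A i)).
Proof.
move=> e0 AP [M HM]; exists M => s us sB.
have /choice[f Hf] : forall b, exists p, b \in s ->
    exists i, [/\ (1 <= i)%N, A i p & (e i * p)%N = b].
  move=> b; case: (boolP (b \in s)) => [/sB[i i1 [p Ap pb]]|]; last by exists 0%N.
  by exists p => _; exists i.
have finj : {in s &, injective f}.
  move=> b c bs cs fbc; have [i [i1 Ai <-]] := Hf b bs; have [j [j1 Aj <-]] := Hf c cs.
  rewrite fbc in Ai *; congr (e _ * _)%N.
  exact: primes_in_class_inj (AP _ _ i1 Ai) (AP _ _ j1 Aj).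
apply: le_trans (HM (map f s) _ _).
- rewrite big_map [leLHS]big_seq [leRHS]big_seq; apply: ler_sum => b bs.
  have [i [i1 Ai bE]] := Hf b bs; have ei0 := e0 i i1.
  have p0 : (0 < f b)%N by case: (AP i _ i1 Ai) => /prime_gt0.
  by rewrite -{1}bE lef_pV2 ?posrE ?ltr0n ?muln_gt0 ?ei0 ?p0 // ler_nat leq_pmull.
- by rewrite map_inj_in_uniq.
- by move=> _ /mapP[b bs ->]; have [i [i1 Ai _]] := Hf b bs; exists i.
Qed.

Theorem corollary1p15 (R : realType) (e : nat -> nat)
    (e_pos : forall i, (1 <= i)%N -> posn (e i))
    (E_minimal : minimal (\bigcup_(i in [set i | (1 <= i)%N]) [set e i])) :
  exists K : nat -> nat,
    (forall i, (1 <= i)%N -> posn (K i)) /\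
    forall A : nat -> set nat,
      (forall i, (1 <= i)%N ->
        [/\ A i `<=` primes_in_class i `&` [set n | (K i <= n)%N],
            infinite_set (A i), pairwise_coprime (A i) & thin R (A i)]) ->
      let E := \bigcup_(i in [set i | (1 <= i)%N]) [set e i] in
      let B := \bigcup_(i in [set i | (1 <= i)%N]) dilate (e i) (A i) in
      [/\ besicovitch R B,
          star B = E &
          thin R (\bigcup_(i in [set i | (1 <= i)%N]) A i) -> taut R B].
Proof.
(* This K i bounds e_i ^ e_i, for the rarity of large multiples, and all e_l with l <= i,
   for primitivity. *)
exists (fun i => prefix_sum e i ^ prefix_sum e i)%N; split.
  by move=> i _; rewrite /posn /= expn_gt0.
move=> A HA E B.
have AP i p : (1 <= i)%N -> A i p -> primes_in_class i p.
  by move=> i1 Ap; have [sub _ _ _] := HA i i1; have [] := sub p Ap.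
have AK i p : (1 <= i)%N -> A i p -> (prefix_sum e i ^ prefix_sum e i <= p)%N.
  by move=> i1 Ap; have [sub _ _ _] := HA i i1; have [] := sub p Ap.
have pp i p : (1 <= i)%N -> A i p -> prime p by move=> i1 /(AP i p i1)[].
have Ae i l p : (1 <= l <= i)%N -> A i p -> (e l < p)%N.
  move=> /[dup] li /andP[l1 /(leq_trans l1) i1] Ap.
  apply: leq_trans (lt_prefix_sum e li) _; apply: leq_trans (AK i p i1 Ap).
  by rewrite -[leqLHS]expn1 leq_pexp2l.
have B0 : B `<=` posn.
  move=> _ [i i1 [p Ap <-]]; rewrite /posn /= muln_gt0.
  by rewrite (e_pos i i1 : (0 < e i)%N) prime_gt0 // (pp i p i1 Ap).
have E0 : E `<=` posn by move=> _ [i i1 ->]; exact: e_pos.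
have Bep b : B b -> exists c p, [/\ b = (c * p)%N, prime p & (c ^ c <= p)%N].
  move=> [i i1 [p Ap <-]]; exists (e i), p; split => //; first exact: pp Ap.
  have ei : (e i <= prefix_sum e i)%N by rewrite ltnW // lt_prefix_sum // leqnn andbT.
  apply: leq_trans (AK i p i1 Ap); apply: (@leq_trans (prefix_sum e i ^ e i)).
    by rewrite leq_exp2r //; exact: (e_pos i i1).
  by rewrite leq_pexp2l.
split.
- apply/cvg_ex; exists (limn (finite_density R B)).
  exact: (erdos_criterion B0 (@large_multiples_rare R B Bep)).
- apply: star_eq => //.
    move=> _ [i i1 [p Ap <-]]; apply/multP; exists (e i); first by exists i.
    exact: dvdn_mulr.
  (* That e_i lies in D(B) is witnessed by A_i itself. *)
  move=> _ [i i1 ->]; split; first exact: e_pos.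
  have [sub infA copA _] := HA i i1; exists (A i); split => //.
    by move=> p Ap; rewrite /posn /= prime_gt0 // (pp i p i1 Ap).
  by move=> b Hb; exists i.
- move=> thA; apply: taut_of_rare_large_multiples => //.
    apply: dilated_primes_primitive => //; by case: E_minimal.
  apply: dilated_primes_bounded_reciprocals => //.
  exact: thin_bounded_reciprocals.
Qed.
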